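(* Let $G$ be a random graph in $G(n,1/2)$. For any positive constants $c$ and $\epsilon$, asymptotically almost surely (as $n\to\infty$) the bipartition number $\tau(G)$ satisfies $$n-c(\log_2 n)^{3+\epsilon}\ \le\ \tau(G)\ \le\ n-(2+o(1))\log_2 n .$$
   Context: $G(n,p)$ denotes the random graph on $n$ labelled vertices in which each pair of vertices is an edge independently with probability $p$. ''Asymptotically almost surely'' means with probability tending to $1$ as $n\to\infty$. The bipartition number $\tau(G)$ of a graph $G$ is the minimum number of complete bipartite subgraphs of $G$ that are pairwise edge-disjoint and whose union is the edge set of $G$ (stars are allowed as complete bipartite graphs). The term $o(1)$ is a deterministic quantity tending to $0$ as $n\to\infty$. *)

(* Defs.v *)
From HB Require Import structures.
From mathcomp Require Import all_boot all_order all_algebra.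
Import Order.TTheory GRing.Theory Num.Theory.

Set Implicit Arguments.
Unset Strict Implicit.
Unset Printing Implicit Defensive.

Local Open Scope ring_scope.

Section Graphs.
Variable T : finType.

Definition pairs : {set {set T}} := [set e : {set T} | #|e| == 2%N].

(** A simple graph with vertex set [T], given by its edge set. *)
Definition sgraph := {E : {set {set T}} | E \subset pairs}.

Definition edges (G : sgraph) : {set {set T}} := val G.

Definition biclique_edges (A B : {set T}) : {set {set T}} :=
  [set [set a; b] | a in A, b in B].

(** Both sides are nonempty, so a complete bipartite subgraph is determined by
    its edge set; stars are the case where one side is a singleton. *)
Definition is_biclique (F : {set {set T}}) : bool :=
  [exists A : {set T}, exists B : {set T},
    [&& A != set0, B != set0, [disjoint A & B] & F == biclique_edges A B]].

Definition biclique_partition (G : sgraph) (P : {set {set {set T}}}) : bool :=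
  partition P (edges G) && [forall F in P, is_biclique F].

Definition has_biclique_partition (G : sgraph) (k : nat) : bool :=
  [exists P : {set {set {set T}}}, biclique_partition G P && (#|P| == k)].

Lemma exists_biclique_partition (G : sgraph) :
  exists k, has_biclique_partition G k.
Proof.
pose P := [set [set e] | e in edges G].
exists #|P|; apply/existsP; exists P; rewrite eqxx andbT; apply/andP; split.
  apply/and3P; split.
  - by rewrite cover_imset; apply/eqP/setP => e; apply/bigcupP/idP =>
      [[f fG /set1P ->] //|eG]; exists e => //; rewrite inE.
  - apply/trivIsetP => _ _ /imsetP[e _ ->] /imsetP[f _ ->] ef.
    by rewrite disjoints1 inE; apply: contraNneq ef => ->.
  - apply/negP => /imsetP[e _] /setP /(_ e).
    by rewrite !inE eqxx.
apply/forall_inP => F /imsetP[e eG ->{F}].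
have := subsetP (valP G) e eG.
rewrite inE => /cards2P[a [b [ab ->]]].
apply/existsP; exists [set a]; apply/existsP; exists [set b].
rewrite -!card_gt0 !cards1 disjoints1 inE ab /=.
apply/eqP/setP => f; rewrite inE; apply/eqP/imset2P => [->|[x y]].
  by exists a b; rewrite ?inE.
by rewrite !inE => /eqP -> /eqP ->.
Qed.

Definition bipartition_number (G : sgraph) : nat :=
  ex_minn (exists_biclique_partition G).

End Graphs.

Section RandomGraph.
Variables (R : comNzRingType) (n : nat) (p : R).

(** The product law under which each pair is an edge independently with
    probability [p]. *)
Definition gnp_mass (G : sgraph 'I_n) : R :=
  \prod_(e in pairs 'I_n) (if e \in edges G then p else 1 - p).

Definition gnp_prob (A : pred (sgraph 'I_n)) : R :=
  \sum_(G | A G) gnp_mass G.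

Lemma gnp_prob_total : gnp_prob predT = 1.
Proof.
pose F e := if e \in pairs 'I_n then p else 0.
pose F' e := if e \in pairs 'I_n then 1 - p else 1.
have /esym : \prod_e (F e + F' e) = 1.
  apply: big1 => e _; rewrite /F /F'.
  by case: ifP => _; rewrite ?add0r // addrC subrK.
rewrite bigA_distr.
rewrite (bigID (fun E : {set {set 'I_n}} => E \subset pairs 'I_n)) /=.
rewrite [X in _ + X]big1 => [|E /subsetPn[e eE ePn]]; last first.
  by rewrite (bigD1 e) //= eE /F (negPf ePn) mul0r.
rewrite addr0 => ->.
rewrite (big_sub (fun E : {set {set 'I_n}} => E \subset pairs 'I_n)).
apply: eq_bigr => G _.
rewrite /gnp_mass big_mkcond; apply: eq_bigr => e _.
rewrite /F /F' /edges; have := subsetP (valP G) e.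
by case: (e \in val G) => [/(_ isT) ->|_].
Qed.

End RandomGraph.

From mathcomp Require Import all_classical all_reals all_analysis.
Import numFieldNormedType.Exports.

Definition aas_gnp (R : realType) (p : R)
    (A : forall n : nat, pred (sgraph 'I_n)) : Prop :=
  ((fun n => gnp_prob p (A n)) @ \oo --> (1 : R))%classic.

Definition log2 (R : realType) (x : R) : R := ln x / ln 2.

(* Main.v *)
Require Import Defs.
From mathcomp Require Import all_boot all_order all_algebra.
From mathcomp Require Import reals sequences exp.
From mathcomp Require Import ring lra zify.
Import Order.TTheory GRing.Theory Num.Theory.

(** Upper bound: by the second moment method G(n,1/2) has an independent set
    of size (2 - o(1)) log2 n, and stars centred at the other vertices, each
    keeping only the edges to later vertices, partition the edges.

    Lower bound: let [P] be a biclique partition with n - d parts. Take a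
    maximal [U] containing a side of at least [#|U|] parts, and let [S] be its
    complement, [m := #|S|]. Each part not killed by [U] meets [S] in a biclique
    with both sides of size at least 2, there are at most m - d of them, and
    m >= d. Let [A] range over their smaller sides. An edge vx of G[S] has to be
    covered through an [A] with x in A, A inside N(v), or conversely. As there
    are at most m blocks [A] and the sum of |A| 2^-|A| over them is O(m), for
    most pairs no such block exists with probability bounded below: a fixed
    family of blocks leaves c m^2 edges uncoverable in expectation, and fewer
    than half as many with probability at most exp(- m^2 / polylog m) by bounded
    differences, which beats the number of choices of [S] and of the blocks
    once m is at least, say, (log2 n)^2. Two kinds of parts are treated apart. Parts whose
    two sides have size at least K = O(log m) cover only O(m log n) edges in
    total, by a first moment computation. Blocks containing a vertex of large
    degree in the block family (a hub) would spoil the bounded differences;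
    but each edge from v to a hub lies in one part only, so they cover few
    edges. *)

Set Implicit Arguments.
Unset Strict Implicit.
Unset Printing Implicit Defensive.

Local Open Scope ring_scope.

(** * Uniform random subsets *)

Section RandomSubset.
Variables (R : realType) (X : finType).
Implicit Types (E Y Z W : {set X}) (f g : {set X} -> R) (A B : pred {set X}).

Definition Ex f : R := (\sum_(E : {set X}) f E) / 2 ^+ #|X|.

Definition Pr A : R := Ex (fun E => (A E)%:R).

Lemma Ex_le f g : (forall E, f E <= g E) -> Ex f <= Ex g.
Proof.
by move=> fg; rewrite ler_pM2r ?invr_gt0 ?exprn_gt0 //; apply: ler_sum.
Qed.

Lemma Ex_eq f g : f =1 g -> Ex f = Ex g.
Proof. by move=> fg; congr (_ / _); apply: eq_bigr. Qed.

Lemma ExZ a f : Ex (fun E => a * f E) = a * Ex f.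
Proof. by rewrite /Ex mulrA mulr_sumr. Qed.

Lemma Ex_sum (I : finType) (P : pred I) (F : I -> {set X} -> R) :
  Ex (fun E => \sum_(i | P i) F i E) = \sum_(i | P i) Ex (F i).
Proof. by rewrite /Ex exchange_big mulr_suml. Qed.

Lemma ExD f g : Ex (fun E => f E + g E) = Ex f + Ex g.
Proof. by rewrite /Ex big_split mulrDl. Qed.

Lemma Ex_cst a : Ex (fun=> a) = a.
Proof.
have cX : #|{set X}| = (2 ^ #|X|)%N by rewrite -!cardsT -powersetT card_powerset.
by rewrite /Ex sumr_const cX -[a *+ _]mulr_natr natrX mulfK // expf_neq0 ?pnatr_eq0.
Qed.

Lemma Pr_le A B : (forall E, A E -> B E) -> Pr A <= Pr B.
Proof. by move=> AB; apply: Ex_le => E; rewrite ler_nat; case: (A E) (AB E) => [->|]. Qed.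

Lemma Pr_eq A B : A =1 B -> Pr A = Pr B.
Proof. by move=> AB; apply: Ex_eq => E; rewrite AB. Qed.

Lemma Pr_ge0 A : 0 <= Pr A.
Proof. by apply: divr_ge0; rewrite ?exprn_ge0 //; apply: sumr_ge0. Qed.

Lemma PrC A : Pr (predC A) = 1 - Pr A.
Proof.
apply/eqP; rewrite eq_sym subr_eq -ExD -{1}(Ex_cst 1); apply/eqP/Ex_eq => E /=.
by case: (A E); rewrite ?add0r ?addr0.
Qed.

Lemma Pr_exists (I : finType) (P : pred I) (F : I -> pred {set X}) :
  Pr (fun E => [exists (i | P i), F i E]) <= \sum_(i | P i) Pr (F i).
Proof.
rewrite -Ex_sum; apply: Ex_le => E.
case: existsP => [[i /andP[Pi Fi]]|_]; last exact: sumr_ge0.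
by rewrite (bigD1 i) //= Fi ler_wpDr ?sumr_ge0.
Qed.

Lemma PrU A B : Pr (fun E => A E || B E) <= Pr A + Pr B.
Proof.
by rewrite -ExD; apply: Ex_le => E; rewrite -natrD ler_nat; case: (A E); case: (B E).
Qed.

(** Removing [Z] maps the sets counted here bijectively onto the subsets of [~: (Z :|: Y)]. *)
Lemma Pr_cylinder Y Z : [disjoint Z & Y] ->
  Pr (fun E => (Z \subset E) && [disjoint Y & E]) = 2^-1 ^+ (#|Z| + #|Y|).
Proof.
move=> ZY.
have -> : Pr (fun E => (Z \subset E) && [disjoint Y & E]) =
    #|powerset (~: (Z :|: Y))|%:R / 2 ^+ #|X|.
  rewrite /Pr /Ex -natr_sum; congr (_%:R / _).
  rewrite -(big_mkcond (fun E => (Z \subset E) && [disjoint Y & E]) (fun=> 1%N)).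
  rewrite sum1dep_card.
  pose h E := E :\: Z.
  rewrite -(card_in_imset (f := h)); last first.
    move=> E E'; rewrite !inE => /andP[/setIidPl ZE _] /andP[/setIidPl ZE' _] /setP hE.
    apply/setP => e; have := hE e; rewrite !inE.
    case: (boolP (e \in Z)) => //= eZ _.
    by move: (eZ) (eZ); rewrite -{1}ZE -{2}ZE' !inE => /andP[_ ->] /andP[_ ->].
  apply: eq_card => F; apply/imsetP/idP.
    case=> E; rewrite !inE => /andP[ZE YE] ->; rewrite /h.
    apply/subsetP => e; rewrite !inE => /andP[eZ eE]; rewrite (negPf eZ) /=.
    by apply: contraTN eE => eY; rewrite (disjointFr YE eY).
  rewrite inE => /subsetP sF; exists (Z :|: F).
    rewrite !inE subsetUl /= -setI_eq0; apply/eqP/setP => e; rewrite !inE.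
    apply/negP => /andP[eY /orP[eZ|/sF]]; first by rewrite (disjointFr ZY eZ) in eY.
    by rewrite !inE eY orbT.
  apply/setP => e; rewrite !inE; case: (boolP (e \in Z)) => //= eZ.
  by apply/negP => /sF; rewrite !inE eZ.
have ZYX : (#|Z| + #|Y| + #|~: (Z :|: Y)| = #|X|)%N.
  by rewrite -(cardsC (Z :|: Y)) cardsU (eqP (_ : #|Z :&: Y| == 0)) ?subn0 // cards_eq0 setI_eq0.
rewrite card_powerset -ZYX exprD natrX exprVn invfM mulrCA divff ?mulr1 //.
by rewrite expf_neq0 ?pnatr_eq0.
Qed.

Lemma Pr_sub Z : Pr (fun E => Z \subset E) = 2^-1 ^+ #|Z|.
Proof.
have := @Pr_cylinder set0 Z; rewrite cards0 addn0 => <-.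
  by apply: Pr_eq => E; rewrite disjoints_subset sub0set andbT.
by rewrite disjoint_sym disjoints_subset sub0set.
Qed.

Lemma Pr_disjoint Y : Pr (fun E => [disjoint Y & E]) = 2^-1 ^+ #|Y|.
Proof.
have := @Pr_cylinder Y set0; rewrite cards0 add0n => <-.
  by apply: Pr_eq => E; rewrite sub0set.
by rewrite disjoints_subset sub0set.
Qed.

(** If [Y] and [Z] overlap the event is impossible, so the cylinder formula survives as an upper
    bound. *)
Lemma Pr_cylinder_le Y Z :
  Pr (fun E => (Z \subset E) && [disjoint Y & E]) <= 2^-1 ^+ (#|Z| + #|Y|).
Proof.
have [ZY|/pred0Pn[e /andP[/= eZ eY]]] := boolP [disjoint Z & Y].
  by rewrite Pr_cylinder.
apply: (@le_trans _ _ (Ex (fun=> 0))); last by rewrite Ex_cst exprn_ge0 ?invr_ge0.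
apply: Ex_le => E; case: andP => // -[/subsetP /(_ e eZ) eE YE].
by rewrite (disjointFr YE eY) in eE.
Qed.

Lemma Pr_markov A f : (forall E, 0 <= f E) -> (forall E, A E -> 1 <= f E) ->
  Pr A <= Ex f.
Proof. by move=> f0 Af; apply: Ex_le => E /=; case: (A E) (Af E) => [->|_]. Qed.

(** On the zero set of [f] the squared deviation from the mean equals the squared mean. The product
    form avoids a division by the mean. *)
Lemma Pr_chebyshev f :
  Pr (fun E => f E == 0) * (Ex f) ^+ 2 <= Ex (fun E => f E ^+ 2) - (Ex f) ^+ 2.
Proof.
set mu := Ex f; have -> : Ex (fun E => f E ^+ 2) - mu ^+ 2 = Ex (fun E => (f E - mu) ^+ 2).
  transitivity (Ex (fun E => f E ^+ 2) + Ex (fun E => (- (2 * mu)) * f E) + Ex (fun=> mu ^+ 2)).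
    by rewrite Ex_cst ExZ -/mu; ring.
  by rewrite -!ExD; apply: Ex_eq => E; ring.
rewrite mulrC -ExZ; apply: Ex_le => E.
case: eqP => [->|_]; first by rewrite sub0r sqrrN mulr1.
by rewrite mulr0 sqr_ge0.
Qed.

Lemma setD1_id e E : e \notin E -> E :\ e = E.
Proof. by move=> eE; apply/setDidPl; rewrite disjoint_sym disjoints1. Qed.

(** Conditional expectation of [f] given the membership of all elements other than [e]. *)
Definition avg1 (e : X) f E : R := (f (e |: E) + f (E :\ e)) / 2.

Lemma sum_avg1 e f : \sum_E avg1 e f E = \sum_E f E.
Proof.
have split g : \sum_E g E = \sum_(E : {set X} | e \notin E) (g E + g (e |: E)).
  rewrite big_split /= (bigID (fun E : {set X} => e \in E)) /= addrC; congr (_ + _).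
  rewrite (reindex_onto (fun E : {set X} => e |: E) (fun E => E :\ e)) /=.
    apply: eq_bigl => E; rewrite !inE eqxx /=.
    apply/eqP/idP => [<-|eE]; first by rewrite !inE eqxx.
    by rewrite setU1K.
  by move=> E eE; rewrite setD1K.
rewrite !split; apply: eq_bigr => E eE.
have -> : avg1 e f (e |: E) = avg1 e f E.
  by rewrite /avg1 setU1K // setUA setUid (setD1_id _) // (setD1_id _).
have -> : avg1 e f E = (f (e |: E) + f E) / 2.
  by rewrite /avg1 (setD1_id _).
by lra.
Qed.

Lemma Ex_avg1 e f : Ex (avg1 e f) = Ex f.
Proof. by rewrite /Ex sum_avg1. Qed.

(** With [d = (a - b) / 2] the left side is exp(-(a + b)/2) cosh d, and cosh d <= 1/(1 - d^2) <= 1 +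
    c^2/2 because d^2 <= c^2/4 and c <= 1. *)
Lemma expR_avg (c a b : R) : c <= 1 -> `|a - b| <= c ->
  (expR (- a) + expR (- b)) / 2 <= expR (c ^+ 2 / 2) * expR (- ((a + b) / 2)).
Proof.
move=> c1 abc; set d := (a - b) / 2.
have abd : 2 * `|d| = `|a - b| by rewrite normrM [`|2^-1|]ger0_norm ?invr_ge0 // mulrC divfK ?pnatr_eq0.
have d2 : d ^+ 2 <= c ^+ 2 / 4.
  rewrite -(real_normK (num_real d)); have := normr_ge0 d; nra.
have dlt : `|d| < 1 by lra.
have [dn dp] : - 1 < d /\ d < 1 by move: dlt; rewrite ltr_norml => /andP[].
have bnd (y : R) : y < 1 -> expR y <= (1 - y)^-1.
  move=> y1; rewrite -[y]opprK expRN lef_pV2 ?posrE ?expR_gt0 ?subr_gt0 ?opprK //.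
  exact: expR_ge1Dx.
have -> : - a = - ((a + b) / 2) - d by rewrite /d; field.
have -> : - b = - ((a + b) / 2) + d by rewrite /d; field.
rewrite !expRD -mulrDr -mulrA mulrC ler_pM2r ?expR_gt0 //.
have h : (expR (- d) + expR d) / 2 <= (1 - d ^+ 2)^-1.
  have e1 := bnd (- d) ltac:(lra); have e2 := bnd d dp.
  have -> : (1 - d ^+ 2)^-1 = ((1 - - d)^-1 + (1 - d)^-1) / 2.
    have n1 : 1 - d != 0 by rewrite subr_eq0 gt_eqF.
    rewrite opprK; have n2 : 1 + d != 0 by rewrite gt_eqF //; lra.
    have -> : 1 - d ^+ 2 = (1 - d) * (1 + d) by ring.
    by field; rewrite n1 n2.
  lra.
apply: (le_trans h); apply: (le_trans _ (expR_ge1Dx _)).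
have c0 : 0 <= c := le_trans (normr_ge0 _) abc.
have c2 : 0 <= c ^+ 2 <= 1 by rewrite sqr_ge0 expr_le1.
move: (c ^+ 2) (d ^+ 2) c2 d2 (sqr_ge0 d) => u v /andP[u0 u1] vu v0.
have uv : 0 <= u * (4^-1 - v) by apply: mulr_ge0 => //; lra.
rewrite -[X in X <= _]mul1r ler_pdivrMr; lra.
Qed.

(* One step of the induction averages out a single element of [W]; this keeps
   the mean and changes the exponential moment by at most [expR (c ^+ 2 / 2)]. *)
Lemma Ex_expR_le (c : R) W f : 0 <= c <= 1 ->
    (forall e E, e \in W -> `|f (e |: E) - f (E :\ e)| <= c) ->
    (forall e E, e \notin W -> f (e |: E) = f (E :\ e)) ->
  Ex (fun E => expR (- f E)) <= expR (c ^+ 2 / 2) ^+ #|W| * expR (- Ex f).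
Proof.
move=> /andP[c0 c1]; move: {2}#|W| (leqnn #|W|) => k.
elim: k W f => [|k IHk] W f; last first.
  case: (set_0Vmem W) => [->|[e eW]] Wk fW fX.
    by apply: IHk fX => //; rewrite ?cards0 // => e E; rewrite inE.
  have Wk' : (#|W :\ e| <= k)%N by move: Wk; rewrite (cardsD1 e) eW.
  have swap e' E : e' != e -> e' |: (E :\ e) = (e' |: E) :\ e.
    move=> e'e; apply/setP => z; rewrite !inE.
    by case: (eqVneq z e') => [->|_] //=; rewrite e'e.
  have swapU e' E : e' != e -> e |: (E :\ e') = (e |: E) :\ e'.
    move=> e'e; apply/setP => z; rewrite !inE.
    by case: (eqVneq z e) => [->|_] //=; rewrite eq_sym e'e.
  have swapD e' E : (E :\ e') :\ e = (E :\ e) :\ e'.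
    by apply/setP => z; rewrite !inE andbCA.
  (* A difference of the averaged function is an average of two differences of [f], so it inherits
     the bound [c], and vanishes outside [W]. *)
  have avgE e' E : e' != e -> avg1 e f (e' |: E) - avg1 e f (E :\ e') =
      ((f (e' |: (e |: E)) - f ((e |: E) :\ e')) + (f (e' |: (E :\ e)) - f ((E :\ e) :\ e'))) / 2.
    move=> e'e; rewrite /avg1 setUCA swapU // swapD (swap _ _ e'e); lra.
  have avgEe E : avg1 e f (e |: E) = avg1 e f (E :\ e).
    rewrite /avg1 setUA setUid setDDl setUid; congr ((f _ + f _) / 2).
      by apply/setP => z; rewrite !inE; case: eqP.
    by apply/setP => z; rewrite !inE; case: eqP.
  have := IHk (W :\ e) (avg1 e f) Wk' _ _.
  rewrite Ex_avg1 => H.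
  rewrite (cardsD1 e W) eW add1n exprS -mulrA.
  apply: le_trans (ler_wpM2l (expR_ge0 _) (H _ _)).
  - rewrite -ExZ -(Ex_avg1 e); apply: Ex_le => E.
    by apply: expR_avg => //; exact: fW.
  - move=> e' E; rewrite !inE => /andP[e'e e'W]; rewrite avgE //.
    have := fW e' (e |: E) e'W; have := fW e' (E :\ e) e'W.
    by rewrite !ler_norml => /andP[? ?] /andP[? ?]; apply/andP; split; lra.
  - move=> e' E; rewrite !inE negb_and negbK => /orP[/eqP -> //|e'W].
    have [-> //|e'e] := eqVneq e' e.
    by apply/eqP; rewrite -subr_eq0 avgE // !(fX e') // !subrr addr0 mul0r.
rewrite leqn0 cards_eq0 => /eqP -> _ fX.
have fc E : f E = f set0.
  have fX' e F : f (e |: F) = f F.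
    have [eF|eF] := boolP (e \in F); first by rewrite (setUidPr _) // sub1set.
    by rewrite fX ?inE // (setD1_id _).
  rewrite -[E]set_enum; elim: (enum E) => [|e s IHs].
    by congr f; apply/setP => z; rewrite !inE.
  by rewrite -IHs -[RHS](fX' e); congr f; apply/setP => z; rewrite !inE.
rewrite cards0 expr0 mul1r (Ex_eq fc) Ex_cst.
rewrite (Ex_eq (g := fun=> expR (- f set0))) ?Ex_cst // => E.
by rewrite fc.
Qed.

(** Exponential Markov inequality for [- l * f], with [Ex_expR_le] applied at the constant [l * c];
    hence the condition [l * c <= 1]. The parameter [l] is left for the caller to optimise. *)
Lemma bounded_differences (c l s : R) W f : 0 <= c -> 0 <= l -> l * c <= 1 ->
    (forall e E, e \in W -> `|f (e |: E) - f (E :\ e)| <= c) ->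
    (forall e E, e \notin W -> f (e |: E) = f (E :\ e)) ->
  Pr (fun E => f E <= Ex f - s) <= expR (#|W|%:R * ((l * c) ^+ 2 / 2) - l * s).
Proof.
move=> c0 l0 lc fW fX.
apply: (@le_trans _ _ (Ex (fun E => expR (l * (Ex f - s)) * expR (- (l * f E))))).
  apply: Pr_markov => E; first by rewrite mulr_ge0 ?expR_ge0.
  move=> fE; rewrite -expRD; apply: le_trans (expR_ge1Dx _).
  by rewrite -[1 in X in X <= _]addr0 lerD2l subr_ge0 ler_wpM2l.
rewrite ExZ; have := @Ex_expR_le (l * c) W (fun E => l * f E) _ _ _.
rewrite ExZ => H; apply: le_trans (ler_wpM2l (expR_ge0 _) (H _ _ _)) _.
- by rewrite mulr_ge0.
- by move=> e E eW; rewrite -mulrBr normrM ger0_norm // ler_wpM2l // fW.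
- by move=> e E eW; rewrite fX.
- by rewrite -expRM_natl -!expRD ler_expR; lra.
Qed.
End RandomSubset.

(** * Sums over subsets, random graphs and stars *)

Section Sums.

Lemma sum_prod_subsets (R : comNzRingType) (T : finType) (A : {set T}) (g : T -> R) :
  \sum_(J : {set T} | J \subset A) \prod_(i in J) g i = \prod_(i in A) (1 + g i).
Proof.
pose F i := if i \in A then g i else 0.
transitivity (\prod_i (F i + 1)); last first.
  rewrite [RHS]big_mkcond; apply: eq_bigr => i _; rewrite /F.
  by case: ifP => _; rewrite ?add0r // addrC.
rewrite bigA_distr big_mkcond; apply: eq_bigr => J _.
case: ifPn => [/subsetP JA|/subsetPn[i iJ iA]].
  rewrite big_mkcond; apply: eq_bigr => i _.
  by case: ifP => // /JA; rewrite /F => ->.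
by rewrite (bigD1 i) //= iJ /F (negPf iA) mul0r.
Qed.

Lemma sum_exp_subsets (R : comNzRingType) (T : finType) (A : {set T}) (y : R) :
  \sum_(J : {set T} | J \subset A) y ^+ #|J| = (1 + y) ^+ #|A|.
Proof.
by rewrite -prodr_const -sum_prod_subsets; apply: eq_bigr => J _; rewrite prodr_const.
Qed.

(** The count is a sum of binomials, compared termwise with the expansion of (1 + |A|)^k: C(|A|, i)
    <= |A|^i <= C(k, i) |A|^i. *)
Lemma card_subsets_lek (T : finType) (A : {set T}) k :
  (#|[set J : {set T} | (J \subset A) && (#|J| <= k)%N]| <= #|A|.+1 ^ k)%N.
Proof.
have -> : #|[set J : {set T} | (J \subset A) && (#|J| <= k)%N]| =
    (\sum_(i < k.+1) 'C(#|A|, i))%N.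
  rewrite -sum1dep_card (partition_big (fun J : {set T} => inord #|J| : 'I_k.+1) predT) //=.
  apply: eq_bigr => i _; rewrite -cards_draws -sum1dep_card; apply: eq_bigl => J.
  rewrite -andbA; case: (J \subset A) => //=.
  apply/andP/eqP => [[Jk /eqP <-]|Ji]; first by rewrite inordK.
  by rewrite Ji -ltnS ltn_ord; split => //; apply/eqP/val_inj; rewrite /= inordK.
rewrite -[#|A|.+1]add1n expnDn; apply: leq_sum => i _; rewrite exp1n mul1n.
apply: (@leq_trans (#|A| ^ i)); last by rewrite leq_pmull // bin_gt0 -ltnS.
apply: (@leq_trans (#|A| ^_ i)); first by rewrite -bin_ffact leq_pmulr // fact_gt0.
rewrite ffact_prod -[X in (_ <= _ ^ X)%N]card_ord -prod_nat_const.
by apply: leq_prod => l _; exact: leq_subr.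
Qed.
End Sums.

(** * Random graphs and the bipartition number *)

Section RandomGraph.
Variable T : finType.

(* A random graph is read off a uniform random set of arbitrary vertex subsets,
   whose members that are not pairs are dummies. *)
Definition graph_of (E : {set {set T}}) : sgraph T := exist _ (E :&: pairs T) (subsetIr _ _).

Lemma in_pairs (u v : T) : ([set u; v] \in pairs T) = (u != v).
Proof. by rewrite inE cards2; case: (u != v). Qed.

Lemma in_graph_of (E : {set {set T}}) (u v : T) : u != v ->
  ([set u; v] \in edges (graph_of E)) = ([set u; v] \in E).
Proof. by move=> uv; rewrite inE in_pairs uv andbT. Qed.

Lemma bipartition_number_le (G : sgraph T) P :
  biclique_partition G P -> (bipartition_number G <= #|P|)%N.
Proof.
move=> GP; rewrite /bipartition_number; case: ex_minnP => k _; apply.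
by apply/existsP; exists P; rewrite GP eqxx.
Qed.

Lemma bipartition_number_attained (G : sgraph T) :
  exists2 P, biclique_partition G P & #|P| = bipartition_number G.
Proof.
rewrite /bipartition_number; case: ex_minnP => k /existsP[P /andP[GP /eqP Pk]] _.
by exists P.
Qed.

Lemma set2_eqP (u v w z : T) : [set u; v] = [set w; z] ->
  (u = w /\ v = z) \/ (u = z /\ v = w).
Proof.
move=> e.
have: u \in [set w; z] by rewrite -e !inE eqxx.
have: v \in [set w; z] by rewrite -e !inE eqxx orbT.
have: w \in [set u; v] by rewrite e !inE eqxx.
have: z \in [set u; v] by rewrite e !inE eqxx orbT.
by rewrite !inE => /orP[]/eqP a /orP[]/eqP b /orP[]/eqP c /orP[]/eqP d;
  first [left; split; congruence | right; split; congruence].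
Qed.

End RandomGraph.

(** Both laws are uniform on graphs: at p = 1/2 all masses agree, and the fibre of [graph_of] over
    [G] is the cylinder requiring the edges of [G] and forbidding the other pairs. *)
Lemma gnp_prob_Pr (R : realType) n (A : pred (sgraph 'I_n)) :
  gnp_prob (2^-1 : R) A = Pr R (fun E => A (graph_of E)).
Proof.
pose Q := pairs 'I_n.
have mass (G : sgraph 'I_n) : gnp_mass (2^-1 : R) G = 2^-1 ^+ #|Q|.
  rewrite /gnp_mass (eq_bigr (fun=> 2^-1)) ?prodr_const // => e _.
  by case: ifP => // _; field.
have fiber (G : sgraph 'I_n) : Pr R (fun E => graph_of E == G) = 2^-1 ^+ #|Q|.
  have GQ := valP G.
  have -> : #|Q| = (#|val G| + #|Q :\: val G|)%N.
    by rewrite -(cardsID (val G) Q) (setIidPr GQ).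
  rewrite -Pr_cylinder; last first.
    by rewrite -setI_eq0 setIDA setIC -setIDA setDv setI0.
  apply: Pr_eq => E; rewrite -val_eqE /= eqEsubset subsetI GQ andbT andbC.
  by congr (_ && _); rewrite -setI_eq0 setIDAC setD_eq0 setIC.
transitivity (\sum_(G | A G) Pr R (fun E => graph_of E == G)).
  by apply: eq_bigr => G _; rewrite fiber mass.
rewrite -Ex_sum; apply: Ex_eq => E.
have [AE|AE] := boolP (A (graph_of E)).
  rewrite (bigD1 (graph_of E)) //= eqxx big1 ?addr0 // => G /andP[_].
  by rewrite eq_sym => /negPf ->.
by rewrite big1 // => G AG; case: eqP => // EG; rewrite -EG (negPf AE) in AG.
Qed.

(** * Star partitions from an independent set *)

Section Stars.
Variables (n : nat) (G : sgraph 'I_n) (I : {set 'I_n}).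
Hypothesis indepI : forall u v, u \in I -> v \in I -> [set u; v] \notin edges G.

(** For centres [v] outside [I]: an edge with one end in [I] is assigned to its other end, an edge
    with both ends outside [I] to its smaller end. *)
Let nbr v := [set w | ([set v; w] \in edges G) && ((w \in I) || (v < w)%N)].
Let star v := biclique_edges [set v] (nbr v).

Let in_star v e : reflect (exists2 w, w \in nbr v & e = [set v; w]) (e \in star v).
Proof.
apply: (iffP imset2P) => [[u w /set1P -> wN ->]|[w wN ->]]; first by exists w.
by exists v w => //; exact: set11.
Qed.

Lemma bipartition_number_indep : (bipartition_number G <= n - #|I|)%N.
Proof.
have edge_neq u v : [set u; v] \in edges G -> u != v.
  by move/(subsetP (valP G)); rewrite in_pairs.
(* Empty stars are removed because parts of a partition are nonempty. Independence of [I] gives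
   every edge an end outside [I], hence a star. *)
pose P := [set star v | v in ~: I] :\ set0.
apply: (@leq_trans #|P|).
  apply: bipartition_number_le; apply/andP; split; last first.
    apply/forall_inP => F; rewrite !inE => /andP[F0 /imsetP[v vI FE]].
    have [e eF] := set0Pn _ F0; rewrite FE in eF.
    have /in_star[w wN _] := eF.
    apply/existsP; exists [set v]; apply/existsP; exists (nbr v); rewrite FE /star eqxx andbT.
    apply/and3P; split; [by apply/set0Pn; exists v; rewrite inE|by apply/set0Pn; exists w|].
    rewrite disjoints1 inE; apply/negP => /andP[/edge_neq].
    by rewrite eqxx.
  apply/and3P; split; last by rewrite !inE eqxx.
  - apply/eqP/setP => e; apply/bigcupP/idP.
      case=> F; rewrite !inE => /andP[_ /imsetP[v _ ->]] /in_star[w].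
      by rewrite inE => /andP[vw _] ->.
    move=> eG; have := subsetP (valP G) _ eG; rewrite inE => /cards2P[u [v [uv eE]]].
    have cov a b : a \notin I -> (b \in I) || (a < b)%N -> e = [set a; b] ->
        exists2 F, F \in P & e \in F.
      move=> aI ab eab; have ea : e \in star a.
        by apply/in_star; exists b => //; rewrite inE -eab eG.
      exists (star a) => //; rewrite !inE; apply/andP; split.
        by apply/set0Pn; exists e.
      by apply: imset_f; rewrite inE.
    have [uI|uI] := boolP (u \in I).
      have vI : v \notin I by apply: contraTN eG => vI; rewrite eE indepI.
      by apply: (cov v u) => //; rewrite ?uI // setUC.
    have [vI|vI] := boolP (v \in I); first by apply: (cov u v) => //; rewrite vI.
    case: (ltngtP u v) => [ltuv|ltvu|/val_inj uv'].
    - by apply: (cov u v) => //; rewrite ltuv orbT.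
    - by apply: (cov v u) => //; rewrite ?ltvu ?orbT // setUC.
    - by rewrite uv' eqxx in uv.
  - apply/trivIsetP => F F'; rewrite !inE => /andP[_ /imsetP[u uI ->]] /andP[_ /imsetP[v vI ->]] uv.
    rewrite -setI_eq0; apply/eqP/setP => e; rewrite !inE; apply/negP => /andP[].
    move=> /in_star[w wu ->] /in_star[z zv] /set2_eqP[[uvE _]|[uz wv]].
      by rewrite uvE eqxx in uv.
    move: wu zv; rewrite !inE in uI vI *; rewrite -uz wv (negPf vI) (negPf uI) /=.
    by move=> /andP[_ uv'] /andP[_]; rewrite ltnNge ltnW.
apply: leq_trans (subset_leq_card (subsetDl _ _)) _.
apply: leq_trans (leq_imset_card _ _) _.
by rewrite cardsCs setCK card_ord.
Qed.
End Stars.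

(** * Independent sets *)

Section IndependentSets.
Variables (R : realType) (T : finType).
Implicit Types (A B : {set T}) (E : {set {set T}}).

Definition pairs_in A : {set {set T}} := [set e : {set T} | (e \subset A) && (#|e| == 2%N)].

Lemma card_pairs_in A : #|pairs_in A| = 'C(#|A|, 2).
Proof. exact: cards_draws. Qed.

Lemma pairs_inI A B : pairs_in A :&: pairs_in B = pairs_in (A :&: B).
Proof. by apply/setP => e; rewrite !inE subsetI andbACA andbb. Qed.

(** C(n - u, k - u) / C(n, k) is the product of (k - i)/(n - i) over i < u, and each factor is at
    most k/n. *)
Lemma leq_bin_ratio n k u : (u <= k)%N -> (k <= n)%N ->
  ('C(n - u, k - u) * n ^ u <= 'C(n, k) * k ^ u)%N.
Proof.
elim: u => [|u IHu] uk kn; first by rewrite !subn0 !expn0.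
have {IHu} := IHu (ltnW uk) kn.
have := mul_bin_diag (n - u) (k - u).-1.
have -> : (n - u).-1 = (n - u.+1)%N by lia.
have -> : (k - u).-1 = (k - u.+1)%N by lia.
have -> : (k - u.+1).+1 = (k - u)%N by lia.
move: ('C(_, _)) ('C(n - u, _)) ('C(n, k)) => c c' C diag IHu.
have nu : (0 < n - u)%N by lia.
rewrite -(leq_pmul2l nu) mulnA diag !expnS.
have kn' : ((k - u) * n <= k * (n - u))%N by nia.
have -> : ((k - u) * c' * (n * n ^ u) = ((k - u) * n) * (c' * n ^ u))%N by lia.
have -> : ((n - u) * (C * (k * k ^ u)) = (k * (n - u)) * (C * k ^ u))%N by lia.
exact: leq_mul.
Qed.

(** Removing [A] turns such a [B] into a subset of [~: A] of size [k - #|A|]; this bounds by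
    (k/n)^|A| the chance that a uniform [k]-set contains [A]. *)
Lemma card_draws_supset A k : (#|A| <= k)%N -> (k <= #|T|)%N ->
  (#|[set B : {set T} | (A \subset B) && (#|B| == k)]| * #|T| ^ #|A|
     <= 'C(#|T|, k) * k ^ #|A|)%N.
Proof.
move=> Ak kT; apply: leq_trans (leq_bin_ratio Ak kT); rewrite leq_mul2r; apply/orP; right.
have -> : (#|T| - #|A| = #|~: A|)%N by rewrite [RHS]cardsCs setCK.
rewrite -cards_draws -(card_in_imset (f := fun B => B :\: A)); last first.
  move=> B B'; rewrite !inE => /andP[AB _] /andP[AB' _] eB.
  by rewrite -(setID B A) -(setID B' A) eB (setIidPr AB) (setIidPr AB').
apply: subset_leq_card; apply/subsetP => x /imsetP[B]; rewrite inE => /andP[AB /eqP <-] ->.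
by rewrite inE subsetDr /= cardsD (setIidPr AB).
Qed.

(** Second moment of the number [Y] of independent [k]-sets. Two [k]-sets meeting in l points are
    correlated by the factor 2^C(l, 2), at most (2^j)^l since l <= 2j. Averaging over the second set
    gives at most (1 + y)^k, so Chebyshev leaves (1 + y)^k - 1. *)
Lemma pr_no_independent k j : k = j.*2 -> (0 < #|T|)%N -> (k <= #|T|)%N ->
  Pr R (fun E => ~~ [exists A : {set T}, (#|A| == k) && [disjoint pairs_in A & E]])
    <= expR (k%:R * (2 ^+ j * k%:R / #|T|%:R)) - 1.
Proof.
move=> kj T0 kT; set y := 2 ^+ j * k%:R / #|T|%:R.
pose N := 'C(#|T|, k); pose a := 'C(k, 2).
have N0 : (0 < N%:R :> R) by rewrite ltr0n bin_gt0.
pose h : R := 2^-1 ^+ a.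
have h0 : 0 < h by rewrite exprn_gt0 ?invr_gt0.
pose Y (E : {set {set T}}) : R := \sum_(A : {set T} | #|A| == k) [disjoint pairs_in A & E]%:R.
have cN : #|[pred A : {set T} | #|A| == k]| = N.
  rewrite /N -(cardsT T) -cards_draws -sum1dep_card -sum1_card; apply: eq_bigl => A.
  by rewrite subsetT.
have ExY : Ex Y = N%:R * h.
  rewrite Ex_sum (eq_bigr (fun=> h)) ?sumr_const ?cN ?mulr_natl //.
  by move=> A /eqP Ak; rewrite -/(Pr R _) Pr_disjoint card_pairs_in Ak.
(* Ratio of the joint probability of independence of [A] and [B] to the product of their
   probabilities. *)
pose w (A B : {set T}) : R := 2 ^+ 'C(#|A :&: B|, 2).
have ExY2 : Ex (fun E => Y E ^+ 2) =
    h ^+ 2 * \sum_(A : {set T} | #|A| == k) \sum_(B : {set T} | #|B| == k) w A B.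
  transitivity (Ex (fun E => \sum_(A : {set T} | #|A| == k) \sum_(B : {set T} | #|B| == k)
      [disjoint pairs_in A :|: pairs_in B & E]%:R : R)).
    apply: Ex_eq => E; rewrite expr2 mulr_suml; apply: eq_bigr => A _.
    rewrite mulr_sumr; apply: eq_bigr => B _.
    by rewrite -!setI_eq0 setIUl setU_eq0 -natrM mulnb.
  rewrite Ex_sum mulr_sumr; apply: eq_bigr => A /eqP Ak.
  rewrite Ex_sum mulr_sumr; apply: eq_bigr => B /eqP Bk.
  rewrite -/(Pr R _) Pr_disjoint /w -card_pairs_in -pairs_inI.
  have := cardsUI (pairs_in A) (pairs_in B); rewrite !card_pairs_in Ak Bk -/a => cUI.
  have h2 : (2^-1 : R) != 0 by rewrite invr_eq0 pnatr_eq0.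
  apply: (mulIf (expf_neq0 #|pairs_in A :&: pairs_in B| h2)).
  by rewrite -exprD cUI -mulrA -exprMn divff ?pnatr_eq0 // expr1n mulr1 expr2 -exprD.
(* Only the summand [U = A :&: B] is kept. Summing over all [U] lets the condition on [B] become
   [U \subset B], which [card_draws_supset] counts. *)
have sub1 (A B : {set T}) : #|A| == k ->
    w A B - 1 <= \sum_(U : {set T} | (U \subset A) && (U != set0)) ((U \subset B)%:R * 2 ^+ j ^+ #|U|).
  move=> /eqP Ak; rewrite /w.
  have t0 (U : {set T}) : 0 <= (U \subset B)%:R * (2 : R) ^+ j ^+ #|U| by rewrite mulr_ge0 ?exprn_ge0.
  have [->|AB] := eqVneq (A :&: B) set0.
    by rewrite cards0 subrr sumr_ge0.
  rewrite (bigD1 (A :&: B)) /=; last by rewrite subsetIl.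
  rewrite subsetIr mul1r ler_wpDr ?sumr_ge0 // lerBlDr ler_wpDr // -exprM.
  rewrite ler_eXn2l ?ltr1n //.
  have := subset_leq_card (subsetIl A B); rewrite Ak kj bin2.
  move: #|A :&: B| => l lk; have := half_leq (leq_mul (leqnn l) (_ : l.-1 <= j.*2)%N).
  by rewrite -doubleMr doubleK mulnC [(j * l)%N]mulnC; apply; lia.
have key (A : {set T}) : #|A| == k ->
    \sum_(B : {set T} | #|B| == k) w A B <= N%:R * (1 + y) ^+ k.
  move=> Ak; have -> : \sum_(B : {set T} | #|B| == k) w A B =
      N%:R + \sum_(B : {set T} | #|B| == k) (w A B - 1).
    by rewrite sumrB sumr_const cN addrC subrK.
  have -> : N%:R * (1 + y) ^+ k =
      N%:R + \sum_(U : {set T} | (U \subset A) && (U != set0)) (N%:R * y ^+ #|U|).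
    rewrite -(eqP Ak) -sum_exp_subsets (bigD1 set0) ?sub0set //= cards0 expr0.
    by rewrite mulrDr mulr1 mulr_sumr.
  rewrite lerD2l; apply: (le_trans (ler_sum _ (fun B _ => sub1 A B Ak))).
  rewrite exchange_big; apply: ler_sum => U /andP[UA _]; rewrite -mulr_suml -natr_sum.
  have -> : (\sum_(B : {set T} | #|B| == k) (U \subset B))%N =
      #|[set B : {set T} | (U \subset B) && (#|B| == k)]|.
    rewrite -sum1dep_card [RHS]big_mkcond [LHS]big_mkcond; apply: eq_bigr => B _.
    by case: (U \subset B); case: (_ == k).
  have Uk : (#|U| <= k)%N by rewrite -(eqP Ak) subset_leq_card.
  have := card_draws_supset Uk kT; rewrite -(ler_nat R) !natrM !natrX -/N => c.
  rewrite /y !exprMn exprVn.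
  set t := 2 ^+ j ^+ #|U|; have t0 : 0 <= t by rewrite !exprn_ge0.
  have -> : N%:R * (t * k%:R ^+ #|U| / #|T|%:R ^+ #|U|) =
      N%:R * k%:R ^+ #|U| / #|T|%:R ^+ #|U| * t by ring.
  by rewrite ler_wpM2r // ler_pdivlMr ?exprn_gt0 ?ltr0n.
have Z : Pr R (fun E => Y E == 0) <= (1 + y) ^+ k - 1.
  have := @Pr_chebyshev R _ Y; rewrite ExY2 ExY.
  set p := Pr R _ => cheb.
  have : h ^+ 2 * (N%:R ^+ 2 * p) <= h ^+ 2 * (N%:R ^+ 2 * ((1 + y) ^+ k - 1)).
    have -> : h ^+ 2 * (N%:R ^+ 2 * p) = p * (N%:R * h) ^+ 2 by ring.
    apply: (le_trans cheb).
    rewrite exprMn [N%:R ^+ 2 * h ^+ 2]mulrC -mulrBr.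
    apply: ler_wpM2l; first exact: exprn_ge0 (ltW h0).
    rewrite mulrBr mulr1 lerD2r.
    apply: (le_trans (ler_sum _ key)); rewrite sumr_const cN.
    by rewrite expr2 -mulrA [leRHS]mulr_natl.
  by rewrite (ler_pM2l (exprn_gt0 2 h0)) (ler_pM2l (exprn_gt0 2 N0)).
apply: (le_trans (y := Pr R (fun E => Y E == 0))).
  apply: Pr_le => E /existsPn noA; rewrite /Y big1 // => A Ak.
  by have := noA A; rewrite Ak /= => /negPf ->.
apply: (le_trans Z); rewrite lerD2r expRM_natl lerXn2r ?nnegrE ?expR_ge0 ?expR_ge1Dx //.
by rewrite addr_ge0 // /y !mulr_ge0 ?exprn_ge0 ?invr_ge0.
Qed.
End IndependentSets.

(** * Bicliques with two large sides *)

Lemma leq_card_bigcup (I X : finType) (B : {set I}) (f : I -> {set X}) :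
  (#|\bigcup_(i in B) f i| <= \sum_(i in B) #|f i|)%N.
Proof.
elim/big_ind2: _ => [|k V k' V' kV kV'|//]; first by rewrite cards0.
exact: leq_trans (leq_card_setU _ _) (leq_add kV kV').
Qed.

Lemma card_bigcup_disjoint (I X : finType) (B : {set I}) (F : I -> {set X}) :
  {in B &, forall i j, i != j -> [disjoint F i & F j]} ->
  #|\bigcup_(i in B) F i| = (\sum_(i in B) #|F i|)%N.
Proof.
move=> dF; rewrite -sum1_card big_mkcond /=.
transitivity (\sum_(i in B) \sum_(e : X) (e \in F i : nat))%N; last first.
  by apply: eq_bigr => i _; rewrite -sum1_card [RHS]big_mkcond; apply: eq_bigr => e _; case: ifP.
rewrite exchange_big; apply: eq_bigr => e _.
case: bigcupP => [[i iB eFi]|eF].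
  rewrite (bigD1 i) //= eFi big1 // => j /andP[jB ji].
  by have := dF j i jB iB ji; move/disjointFl => /(_ _ eFi) ->.
by rewrite big1 // => i iB; apply/eqP; rewrite eqb0; apply/negP => eFi; apply: eF; exists i.
Qed.

Section BigBicliques.
Variables (R : realType) (T : finType).
Implicit Types (A B S : {set T}) (p q : {set T} * {set T}).

Lemma card_biclique_edges A B : [disjoint A & B] ->
  #|biclique_edges A B| = (#|A| * #|B|)%N.
Proof.
move=> AB; rewrite /biclique_edges curry_imset2X card_in_imset ?cardsX //.
move=> [a b] [a' b'] /setXP[/= aA bB] /setXP[/= aA' bB'] /set2_eqP[[-> ->] //|[ab' _]].
by rewrite -ab' (disjointFr AB aA) in bB'.
Qed.

Definition big_family S K (F : {set {set T} * {set T}}) :=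
  [forall p in F, [&& p.1 \subset S, p.2 \subset S, (K <= #|p.1|)%N, (K <= #|p.2|)%N
     & [disjoint p.1 & p.2]]] &&
  [forall p in F, forall q in F,
     (p != q) ==> [disjoint biclique_edges p.1 p.2 & biclique_edges q.1 q.2]].

Definition family_edges (F : {set {set T} * {set T}}) :=
  \bigcup_(p in F) biclique_edges p.1 p.2.

Lemma card_family_edges S K F : big_family S K F ->
  #|family_edges F| = (\sum_(p in F) #|p.1| * #|p.2|)%N.
Proof.
move=> /andP[/forall_inP FS /forall_inP Fd].
rewrite card_bigcup_disjoint.
  by apply: eq_bigr => p /FS /and5P[_ _ _ _ pd]; rewrite card_biclique_edges.
by move=> p q pF qF pq; have /forall_inP /(_ q qF) /implyP := Fd p pF; apply.
Qed.

(** First moment over all families. Writing 1/2 = (2/3)(3/4), the factor 2/3 per edge yields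
    (2/3)^X, while the factor 3/4 per edge pays for the number of families: the sum over families is
    at most the product of the [1 + g p], hence at most exp of the sum of [g]. *)
Lemma pr_big_family S K X : (0 < #|S|)%N -> (3 / 4 : R) ^+ K <= #|S|%:R ^- 4 ->
  Pr R (fun E => [exists F, [&& big_family S K F, (X <= #|family_edges F|)%N
                              & family_edges F \subset E]])
    <= expR (expR 2) * (2 / 3) ^+ X.
Proof.
move=> S0 K34; set m := #|S| in S0 K34 *.
have m0 : 0 < m%:R :> R by rewrite ltr0n.
have a34 : 0 <= 3 / 4 :> R by lra.
have a23 : 0 <= 2 / 3 :> R by lra.
pose g p : R := (3 / 4) ^+ (#|p.1| * #|p.2|).
have g0 p : 0 <= g p by rewrite exprn_ge0.
pose Omega := [set p : {set T} * {set T} |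
  [&& p.1 \subset S, p.2 \subset S, (K <= #|p.1|)%N & (K <= #|p.2|)%N]].
pose good F := big_family S K F && (X <= #|family_edges F|)%N.
apply: (@le_trans _ _ (\sum_(F | good F) Pr R (fun E => family_edges F \subset E))).
  apply: le_trans (Pr_exists _ _ _); apply: Pr_le => E /existsP[F /and3P[F1 F2 F3]].
  by apply/existsP; exists F; rewrite /good F1 F2.
apply: (@le_trans _ _ (\sum_(F | good F) (2 / 3) ^+ X * \prod_(p in F) g p)).
  apply: ler_sum => F /andP[FS XF]; rewrite Pr_sub.
  have -> : \prod_(p in F) g p = (3 / 4) ^+ #|family_edges F|.
    by rewrite (card_family_edges FS) -prodrXr.
  have -> : (2^-1 : R) = (2 / 3) * (3 / 4) by field.
  rewrite exprMn ler_wpM2r ?exprn_ge0 // ler_wiXn2l //; lra.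
rewrite -mulr_sumr mulrC ler_wpM2r ?exprn_ge0 //.
apply: (@le_trans _ _ (\sum_(F : {set _} | F \subset Omega) \prod_(p in F) g p)).
  rewrite big_mkcond [leRHS]big_mkcond; apply: ler_sum => F _.
  have p0 : 0 <= \prod_(p in F) g p by rewrite prodr_ge0.
  case: ifPn => [/andP[/andP[/forall_inP FS _] _]|_]; last by case: ifP.
  by case: ifPn => // /subsetPn[p /FS]; rewrite inE => /and5P[-> -> -> -> _].
rewrite sum_prod_subsets.
apply: (@le_trans _ _ (\prod_(p in Omega) expR (g p))).
  apply: ler_prod => p _; rewrite expR_ge1Dx andbT; apply: addr_ge0 => //.
rewrite -expR_sum ler_expR.
pose y : R := m%:R ^- 2.
have y0 : 0 <= y by rewrite invr_ge0 exprn_ge0.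
(* With both sides at least [K], 2ab >= K(a + b), so the square of (3/4)^(ab) is at most (m^-4)^(a +
   b). The bound then factors over the two sides. *)
have gy p : p \in Omega -> g p <= y ^+ #|p.1| * y ^+ #|p.2|.
  rewrite inE => /and4P[_ _ K1 K2]; rewrite -exprD /g.
  have ab : (K * (#|p.1| + #|p.2|) <= #|p.1| * #|p.2| * 2)%N.
    have := leq_mul K1 (leqnn #|p.2|); have := leq_mul (leqnn #|p.1|) K2; lia.
  rewrite -(@ler_pXn2r _ 2) ?nnegrE ?exprn_ge0 // -!exprM.
  apply: (@le_trans _ _ ((3 / 4) ^+ (K * (#|p.1| + #|p.2|)))).
    by rewrite ler_wiXn2l //; lra.
  rewrite exprM mulnC exprM lerXn2r ?nnegrE ?exprn_ge0 //.
  by rewrite /y exprVn -exprM.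
have sy : \sum_(A : {set T} | A \subset S) y ^+ #|A| <= expR 1.
  rewrite sum_exp_subsets -/m.
  apply: (@le_trans _ _ (expR (m%:R * m%:R^-1))); last by rewrite divff ?gt_eqF.
  rewrite expRM_natl lerXn2r ?nnegrE ?expR_ge0 ?addr_ge0 //.
  apply: le_trans (expR_ge1Dx _); rewrite lerD2l /y.
  rewrite lef_pV2 ?posrE ?exprn_gt0 // expr2 ler_peMr ?(ltW m0) //.
  by rewrite ler1n.
have -> : (2 : R) = 1 + 1 by [].
rewrite expRD; apply: le_trans (ler_pM _ _ sy sy); last 2 first.
- by apply: sumr_ge0 => A _; rewrite exprn_ge0.
- by apply: sumr_ge0 => A _; rewrite exprn_ge0.
rewrite big_distrlr /= pair_big /= big_mkcond [leRHS]big_mkcond /=.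
apply: ler_sum => p _; have yy : 0 <= y ^+ #|p.1| * y ^+ #|p.2| by rewrite mulr_ge0 ?exprn_ge0.
case: ifPn => [pO|_]; last by case: ifP.
by move: (pO); rewrite inE => /and4P[-> -> _ _] /=; exact: gy.
Qed.

End BigBicliques.

(** * Edges that a family of blocks cannot cover *)

Section UncoverablePairs.
Variables (R : realType) (T : finType).
Implicit Types (A B S : {set T}) (E Fam : {set {set T}}) (v x y : T).

Definition nbr E v : {set T} := [set y | (y != v) && ([set v; y] \in E)].

(** If a part contains the edge [vx] with [x] in its smaller side [A], then [A] lies in the
    neighbourhood of [v]. Hence an uncoverable edge lies in no part whose smaller side belongs to
    [Fam]. *)
Definition uncoverable E Fam v x := (x \in nbr E v) &&
  [forall A in Fam, ~~ ((x \in A) && (A \subset nbr E v)) &&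
                    ~~ ((v \in A) && (A \subset nbr E x))].

Definition uncoverables E Fam S := [set p in setX S S | uncoverable E Fam p.1 p.2].

Lemma uncoverable_eq E E' Fam v x :
    (x \in nbr E v) = (x \in nbr E' v) ->
    (forall A, A \in Fam -> x \in A -> (A \subset nbr E v) = (A \subset nbr E' v)) ->
    (forall A, A \in Fam -> v \in A -> (A \subset nbr E x) = (A \subset nbr E' x)) ->
  uncoverable E Fam v x = uncoverable E' Fam v x.
Proof.
move=> xv Ax Av; rewrite /uncoverable xv; congr (_ && _).
apply: eq_forallb => A; case: (boolP (A \in Fam)) => //= AF.
congr (_ && _); congr (~~ _).
  by case: (boolP (x \in A)) => //= /(Ax A AF).
by case: (boolP (v \in A)) => //= /(Av A AF).
Qed.

Lemma in_nbr_flip (e : {set T}) E v y : (v != y -> [set v; y] != e) ->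
  (y \in nbr (e |: E) v) = (y \in nbr (E :\ e) v).
Proof.
rewrite !inE; have [-> //|yv] := eqVneq y v.
by move=> /(_ isT) /negPf ->.
Qed.

Lemma sub_nbr_flip (e : {set T}) E v A :
    (forall y, y \in A -> v != y -> [set v; y] != e) ->
  (A \subset nbr (e |: E) v) = (A \subset nbr (E :\ e) v).
Proof.
move=> Ae; apply/subsetP/subsetP => AN y yA; have := AN y yA.
  by rewrite (in_nbr_flip _ (Ae y yA)).
by rewrite (in_nbr_flip _ (Ae y yA)).
Qed.

(** For [v], [x] in [S] and blocks inside [S], only pairs inside [S] are ever queried. *)
Lemma uncoverables_flip_out (e : {set T}) E Fam S :
    (forall A, A \in Fam -> A \subset S) -> e \notin pairs_in S ->
  uncoverables (e |: E) Fam S = uncoverables (E :\ e) Fam S.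
Proof.
move=> FS eS; apply/setP => -[v x]; rewrite !inE /=.
case: (boolP (v \in S)) => //= vS; case: (boolP (x \in S)) => //= xS.
have notin u y : u \in S -> y \in S -> u != y -> [set u; y] != e.
  move=> uS yS uy; apply: contraNneq eS => <-.
  by rewrite !inE subUset !sub1set uS yS cards2 uy.
apply: uncoverable_eq.
- by apply: in_nbr_flip => ?; apply: notin.
- by move=> A AF _; apply: sub_nbr_flip => y /(subsetP (FS A AF)) yS; apply: notin.
- by move=> A AF _; apply: sub_nbr_flip => y /(subsetP (FS A AF)) yS; apply: notin.
Qed.

(** The pair [e] is queried from the end [v] when deciding on [(v, x)]: it is [vx] itself or joins
    [v] to a vertex sharing a block with [x]. *)
Let touch Fam (e : {set T}) v x := [exists y, ([set v; y] == e) &&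
  ((y == x) || [exists A in Fam, (x \in A) && (y \in A)])].

Let affected Fam (e : {set T}) :=
  [set p : T * T | touch Fam e p.1 p.2] :|: [set p : T * T | touch Fam e p.2 p.1].

Let uncoverable_flip Fam (e : {set T}) E v x : (v, x) \notin affected Fam e ->
  uncoverable (e |: E) Fam v x = uncoverable (E :\ e) Fam v x.
Proof.
rewrite !inE /= negb_or => /andP[/existsPn tv /existsPn tx].
have notin a b A y : (forall z, ~~ (([set a; z] == e) &&
    ((z == b) || [exists A in Fam, (b \in A) && (z \in A)]))) ->
    A \in Fam -> b \in A -> y \in A -> [set a; y] != e.
  move=> ta AF bA yA; have := ta y; apply: contraNneq => ->; rewrite eqxx /=.
  by apply/orP; right; apply/exists_inP; exists A; rewrite ?bA.
apply: uncoverable_eq.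
- apply: in_nbr_flip => _; have := tv x; apply: contraNneq => ->.
  by rewrite !eqxx.
- by move=> A AF xA; apply: sub_nbr_flip => y yA _; exact: notin tv AF xA yA.
- by move=> A AF xA; apply: sub_nbr_flip => y yA _; exact: notin tx AF xA yA.
Qed.

Definition degree Fam y := #|[set A in Fam | y \in A]|.

(** Here [v] is one of the two ends of [e], and [x] is the other end or shares one of its at most
    [D] blocks. *)
Let card_touch Fam (e : {set T}) D K : #|e| = 2%N ->
    (forall y, (degree Fam y <= D)%N) -> (forall A, A \in Fam -> (#|A| <= K)%N) ->
  (#|[set p : T * T | touch Fam e p.1 p.2]| <= 2 * (1 + D * K))%N.
Proof.
move=> /eqP/cards2P[u [w [uw ->]]] degD AK.
pose N y := y |: \bigcup_(A in [set A in Fam | y \in A]) A.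
have cN y : (#|N y| <= 1 + D * K)%N.
  rewrite cardsU1; apply: leq_add; first by case: (_ \notin _).
  apply: (@leq_trans (\sum_(A in [set A in Fam | y \in A]) K)); last first.
    by rewrite sum_nat_const leq_mul2r degD orbT.
  apply: leq_trans (leq_card_bigcup _ _) _.
  by apply: leq_sum => A; rewrite inE => /andP[/AK].
rewrite mul2n -addnn; apply: leq_trans (leq_add (cN w) (cN u)).
rewrite -[#|N w|]mul1n -(cards1 u) -cardsX -[#|N u|]mul1n -(cards1 w) -cardsX.
apply: leq_trans (subset_leq_card _) (leq_card_setU _ _).
apply/subsetP => -[v x]; rewrite inE /= => /existsP[y /andP[/eqP /set2_eqP vy xy]].
have xN : x \in N y.
  rewrite !inE; case/orP: xy => [/eqP -> |/exists_inP[A AF /andP[xA yA]]].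
    by rewrite eqxx.
  by apply/orP; right; apply/bigcupP; exists A => //; rewrite inE AF.
by case: vy xN => -[-> ->] xN; apply/setUP; [left|right]; apply/setXP; rewrite /= set11.
Qed.

(** The factor 4 counts two ends of [e] and two orientations of the pair. *)
Lemma uncoverables_flip_in (e : {set T}) E Fam S D K : #|e| = 2%N ->
    (forall y, (degree Fam y <= D)%N) -> (forall A, A \in Fam -> (#|A| <= K)%N) ->
  `|#|uncoverables (e |: E) Fam S|%:R - #|uncoverables (E :\ e) Fam S|%:R|
    <= (4 * (1 + D * K))%:R :> R.
Proof.
move=> e2 dD AK.
have cA : (#|affected Fam e| <= 4 * (1 + D * K))%N.
  apply: leq_trans (leq_card_setU _ _) _.
  have -> : #|[set p : T * T | touch Fam e p.2 p.1]| = #|[set p : T * T | touch Fam e p.1 p.2]|.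
    rewrite -(card_imset _ (can_inj (@swap_pairK T T))); apply: eq_card => -[a b].
    apply/imsetP/idP; first by case=> -[c d]; rewrite !inE /= => tcd [-> ->].
    by rewrite inE /= => tab; exists (b, a); rewrite ?inE.
  have := card_touch e2 dD AK; lia.
have sub E1 E2 : (forall v x, (v, x) \notin affected Fam e ->
    uncoverable E1 Fam v x = uncoverable E2 Fam v x) ->
    (#|uncoverables E1 Fam S| <= #|uncoverables E2 Fam S| + 4 * (1 + D * K))%N.
  move=> E12; apply: leq_trans (leq_add (leqnn _) cA).
  apply: leq_trans (subset_leq_card _) (leq_card_setU _ _).
  apply/subsetP => -[v x]; rewrite in_setU orbC => bvx.
  have [//|/E12 vx] := boolP (_ \in affected _ _); move: bvx.
  by rewrite !inE /= vx.
have /sub := fun v x => @uncoverable_flip Fam e E v x; rewrite -(ler_nat R) natrD => h1.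
have /sub : forall v x, (v, x) \notin affected Fam e ->
    uncoverable (E :\ e) Fam v x = uncoverable (e |: E) Fam v x.
  by move=> v x /uncoverable_flip ->.
rewrite -(ler_nat R) natrD => h2.
by rewrite ler_norml; apply/andP; split; lra.
Qed.

End UncoverablePairs.

Lemma markov_count (R : realDomainType) (T : finType) (S : {set T}) (g : T -> R) (a : R) :
  (forall x, 0 <= g x) -> a * #|[set x in S | a < g x]|%:R <= \sum_(x in S) g x.
Proof.
move=> g0; rewrite mulr_natr -sumr_const big_mkcond [leRHS]big_mkcond.
apply: ler_sum => x _; rewrite inE; case: (x \in S) => //=.
by case: ifP => [/ltW|].
Qed.

(** * Mean and concentration of the number of uncoverable pairs *)

Section Expectation.
Variables (R : realType) (T : finType).
Implicit Types (A B S : {set T}) (E Fam : {set {set T}}) (v x y : T).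

(** Blocks are cut at size 8 because a 2^-a <= 1/32 from a = 8 on, which keeps the union bound over
    larger blocks below 1/2 for most vertices. *)
Let P Fam x := [set A in Fam | (x \in A) && (#|A| < 8)%N].
Let Q Fam x := [set A in Fam | (x \in A) && (8 <= #|A|)%N].
Let wQ Fam x : R := \sum_(A in Q Fam x) 2^-1 ^+ #|A|.

Let half0 : 0 <= 2^-1 :> R. Proof. by rewrite invr_ge0. Qed.
Let half1 : 2^-1 <= 1 :> R. Proof. lra. Qed.

Let wQ_ge0 Fam x : 0 <= wQ Fam x.
Proof. by apply: sumr_ge0 => A _; rewrite exprn_ge0. Qed.

Let edges_at v A : {set {set T}} := [set [set v; y] | y in A].

Let card_edges_at v A : #|edges_at v A| = #|A|.
Proof.
by rewrite card_imset // => y z /set2_eqP[[]//|[<- ->]].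
Qed.

Let sub_edges_at E v A : A \subset nbr E v -> edges_at v A \subset E.
Proof.
by move=> /subsetP AE; apply/subsetP => _ /imsetP[y /AE yE ->]; move: yE; rewrite inE => /andP[].
Qed.

(* A witness [y != x] from each small block through [x] is asked to be
   nonadjacent to [v] (and symmetrically); the blocks of size at least 8 are
   then handled by the union bound. *)
Let pr_uncoverable Fam v x : (forall A, A \in Fam -> (2 <= #|A|)%N) -> v != x ->
  2^-1 ^+ (#|P Fam x| + #|P Fam v|) * (2^-1 - wQ Fam x - wQ Fam v)
    <= Pr R (fun E => uncoverable E Fam v x).
Proof.
move=> F2 vx.
have [h0|h0] := leP (2^-1 - wQ Fam x - wQ Fam v) 0.
  by apply: le_trans (Pr_ge0 _ _); rewrite mulr_ge0_le0 ?exprn_ge0.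
(* The default [z] could occur only for [A :\ z] empty, which a block of size at least 2
   excludes. *)
pose wit A z := odflt z [pick y in A :\ z].
have witP A z : A \in Fam -> wit A z \in A :\ z \/ z \notin A.
  move=> AF; rewrite /wit; case: pickP => [y //|A0]; first by left.
  right; apply: contraTN (F2 A AF) => zA; rewrite -ltnNge (cardsD1 z) zA.
  by rewrite (eq_card0 A0).
pose Y := [set [set v; wit A x] | A in P Fam x] :|: [set [set x; wit A v] | A in P Fam v].
have cY : (#|Y| <= #|P Fam x| + #|P Fam v|)%N.
  by apply: leq_trans (leq_card_setU _ _) _; apply: leq_add; apply: leq_imset_card.
pose cyl E := ([set [set v; x]] \subset E) && [disjoint Y & E].
have prcyl : Pr R cyl = 2^-1 ^+ #|Y| * 2^-1.
  rewrite Pr_cylinder ?cards1 ?add1n ?exprSr //.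
  rewrite disjoints1 inE negb_or; apply/andP; split; apply/imsetP => -[A].
    rewrite inE => /and3P[AF xA _]; case: (witP A x AF) => [|]; last by rewrite xA.
    rewrite !inE => /andP[wx _] /set2_eqP[[_ /esym/eqP]|[/esym wv xv]]; first by rewrite (negPf wx).
    by rewrite xv eqxx in vx.
  rewrite inE => /and3P[AF vA _]; case: (witP A v AF) => [|]; last by rewrite vA.
  rewrite !inE => /andP[wv _] /set2_eqP[[/eqP]|[/esym/eqP]]; first by rewrite (negPf vx).
  by rewrite (negPf wv).
(* On [cyl] every small block through [x] or [v] has a missing witness, so a failure comes from a
   block of size at least 8. Keeping [Y] in those events retains the common factor 2^-|Y|. *)
have cylE : Pr R cyl <= Pr R (fun E => uncoverable E Fam v x)
    + (\sum_(A in Q Fam x) 2^-1 ^+ (#|A| + #|Y|) + \sum_(A in Q Fam v) 2^-1 ^+ (#|A| + #|Y|)).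
  pose ev z A E := (edges_at z A \subset E) && [disjoint Y & E].
  have ub z w : Pr R (fun E => [exists A in Q Fam w, ev z A E]) <=
      \sum_(A in Q Fam w) 2^-1 ^+ (#|A| + #|Y|).
    apply: le_trans (Pr_exists _ _ _) _; apply: ler_sum => A _.
    by rewrite -(card_edges_at z A) Pr_cylinder_le.
  apply: le_trans (lerD (lexx _) (lerD (ub v x) (ub x v))).
  apply: le_trans (lerD (lexx _) (PrU _ _ _)); apply: le_trans (PrU _ _ _).
  apply: Pr_le => E /andP[vxE YE].
  have [//|nb] := boolP (uncoverable E Fam v x); rewrite /=.
  have xv : x \in nbr E v by rewrite inE eq_sym vx -sub1set.
  move: nb; rewrite /uncoverable xv /= negb_forall_in => /exists_inP[A AF].
  have sym z w : (forall B, B \in P Fam w -> [set z; wit B w] \in Y) ->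
      (w \in A) && (A \subset nbr E z) -> [exists A in Q Fam w, ev z A E].
    move=> BY /andP[wA Az]; apply/exists_inP; exists A; last by rewrite /ev YE sub_edges_at.
    rewrite inE AF wA /= leqNgt; apply/negP => A8.
    have AP : A \in P Fam w by rewrite inE AF wA.
    case: (witP A w AF) => [|]; last by rewrite wA.
    rewrite inE => /andP[_ /(subsetP Az)]; rewrite inE => /andP[_ wE].
    by have := BY A AP => /(disjointFr YE); rewrite wE.
  rewrite negb_and !negbK => /orP[/sym->|/sym->] //; rewrite ?orbT // => B BP.
    by apply/setUP; left; apply/imsetP; exists B.
  by apply/setUP; right; apply/imsetP; exists B.
have sumQ z : \sum_(A in Q Fam z) 2^-1 ^+ (#|A| + #|Y|) = 2^-1 ^+ #|Y| * wQ Fam z.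
  by rewrite mulr_sumr; apply: eq_bigr => A _; rewrite exprD mulrC.
rewrite !sumQ prcyl in cylE.
apply: (@le_trans _ _ (2^-1 ^+ #|Y| * (2^-1 - wQ Fam x - wQ Fam v))); last first.
  by rewrite !mulrBr -addrA -opprD lerBlDr.
by rewrite ler_wpM2r ?(ltW h0) // ler_wiXn2l.
Qed.

Let degrees_le Fam S : (#|Fam| <= #|S|)%N ->
  \sum_(x in S) #|P Fam x|%:R <= 8 * #|S|%:R :> R.
Proof.
move=> FS; rewrite -natr_sum -natrM ler_nat.
apply: (@leq_trans (\sum_(A in Fam) 8)); last by rewrite sum_nat_const mulnC leq_mul2l FS.
have -> : (\sum_(x in S) #|P Fam x| = \sum_(x in S) \sum_(A in Fam) ((x \in A) && (#|A| < 8)))%N.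
  apply: eq_bigr => x _; rewrite -sum1dep_card big_mkcondr.
  by apply: eq_bigr => A _; case: (_ && _).
rewrite exchange_big; apply: leq_sum => A _.
have [A8|A8] := ltnP #|A| 8; last by rewrite big1 // => x _; rewrite andbF.
apply: leq_trans (ltnW A8); rewrite -sum1_card big_mkcond [leqRHS]big_mkcond.
by apply: leq_sum => x _; case: (x \in S); case: (x \in A).
Qed.

(** Double counting: a block [A] of size at least 8 contributes at most |A| 2^-|A| <= 1/32. *)
Let weights_le Fam S : (#|Fam| <= #|S|)%N -> \sum_(x in S) wQ Fam x <= #|S|%:R / 32.
Proof.
move=> FS; apply: (@le_trans _ _ (\sum_(A in Fam) (32^-1 : R))); last first.
  by rewrite sumr_const -[leLHS]mulr_natl ler_pM2r ?invr_gt0 // ler_nat.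
have -> : \sum_(x in S) wQ Fam x =
    \sum_(x in S) \sum_(A in Fam) (if (x \in A) && (8 <= #|A|)%N then 2^-1 ^+ #|A| else 0).
  apply: eq_bigr => x _; rewrite /wQ -big_mkcondr.
  by apply: eq_bigl => A; rewrite inE.
rewrite exchange_big; apply: ler_sum => A _ /=.
have [A8|A8] := leqP 8 #|A|; last first.
  by rewrite big1 ?invr_ge0 // => x _; rewrite andbF.
apply: (@le_trans _ _ (\sum_(x in A) 2^-1 ^+ #|A|)).
  rewrite big_mkcond [leRHS]big_mkcond; apply: ler_sum => x _.
  by rewrite andbT; case: (x \in S); case: (x \in A); rewrite ?exprn_ge0.
rewrite sumr_const -[leLHS]mulr_natl exprVn ler_pdivrMr ?exprn_gt0 // mulrC.
rewrite ler_pdivlMr // -natrX -natrM ler_nat.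
move: #|A| A8; elim=> // a IHa; rewrite leq_eqVlt => /orP[/eqP <- //|a8].
by have := IHa a8; rewrite expnS; lia.
Qed.

(** By Markov, at most a quarter of [S] violates each condition defining [L], so |L| >= |S|/2.
    Distinct vertices of [L] give probability at least 2^-64 (1/2 - 1/8 - 1/8) = 2^-66, and |L|(|L|
    - 1) >= |S|^2/8. *)
Lemma Ex_uncoverables_ge Fam S : (4 <= #|S|)%N -> (#|Fam| <= #|S|)%N ->
    (forall A, A \in Fam -> (2 <= #|A|)%N) ->
  2^-1 ^+ 69 * #|S|%:R ^+ 2 <= Ex (fun E => #|uncoverables E Fam S|%:R : R).
Proof.
move=> S4 FS F2.
pose L := [set x in S | (#|P Fam x| <= 32)%N && (wQ Fam x <= 8^-1)].
have LS : L \subset S by apply/subsetP => x; rewrite inE => /andP[].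
have cL : #|S|%:R <= 2 * #|L|%:R :> R.
  have h1 := @markov_count R _ S (fun x => #|P Fam x|%:R) 32 ltac:(by []).
  have h2 := @markov_count R _ S (wQ Fam) 8^-1 (wQ_ge0 Fam).
  have d1 := degrees_le FS; have d2 := weights_le FS.
  have : (#|S| <= #|L| + (#|[set x in S | (32 < #|P Fam x|%:R :> R)%R]|
                          + #|[set x in S | (8^-1 < wQ Fam x)%R]|))%N.
    apply: leq_trans (leq_add (leqnn _) (leq_card_setU _ _)).
    apply: leq_trans (subset_leq_card _) (leq_card_setU _ _).
    apply/subsetP => x xS; rewrite !inE xS /= (ltr_nat R 32).
    by case: (leqP #|P Fam x| 32) => //= _; case: (leP (wQ Fam x) 8^-1).
  rewrite -(ler_nat R) !natrD; lra.
have prL v x : v \in L -> x \in L -> v != x -> 2^-1 ^+ 66 <= Pr R (fun E => uncoverable E Fam v x).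
  rewrite !inE => /and3P[_ Pv Qv] /and3P[_ Px Qx] vx.
  apply: le_trans (pr_uncoverable F2 vx).
  apply: (@le_trans _ _ (2^-1 ^+ 64 * (2^-1 ^+ 2))); first by rewrite -exprD.
  apply: ler_pM; rewrite ?exprn_ge0 // ?ler_wiXn2l //; first by lia.
  by rewrite expr2; lra.
have -> : Ex (fun E => #|uncoverables E Fam S|%:R : R) =
    \sum_(p in setX S S) Pr R (fun E => uncoverable E Fam p.1 p.2).
  rewrite -Ex_sum; apply: Ex_eq => E; rewrite -natr_sum -sum1_card; congr (_%:R).
  rewrite big_mkcond [RHS]big_mkcond; apply: eq_bigr => p _; rewrite !inE.
  by case: (p.1 \in S); case: (p.2 \in S); case: (uncoverable _ _ _ _).
apply: (@le_trans _ _ (\sum_(v in L) \sum_(x in L :\ v) 2^-1 ^+ 66)).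
  rewrite (eq_bigr (fun=> (#|L|.-1)%:R * 2^-1 ^+ 66 : R)); last first.
    by move=> v vL; rewrite sumr_const -[LHS]mulr_natl [#|L|](cardsD1 v) vL.
  rewrite sumr_const -[leRHS]mulr_natl.
  have -> : (2^-1 : R) ^+ 69 = 2^-1 ^+ 66 * 8^-1 by rewrite (exprD _ 66 3); congr (_ * _); field.
  have : 4 <= #|S|%:R :> R by rewrite (ler_nat R 4).
  have L0 : (0 < #|L|)%N.
    by move: cL; case: #|L| => // ; rewrite mulr0 (ler_nat R _ 0) leqn0 => /eqP S0; rewrite S0 in S4.
  have -> : (#|L|.-1)%:R = #|L|%:R - 1 :> R by rewrite -subn1 natrB.
  move: cL; set l : R := #|L|%:R; set s : R := #|S|%:R => cL s4.
  have -> : l * ((l - 1) * 2^-1 ^+ 66) = 2^-1 ^+ 66 * (l * (l - 1)) by ring.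
  rewrite -mulrA ler_wpM2l ?exprn_ge0 //; nra.
rewrite pair_big_dep /= big_mkcond [leRHS]big_mkcond /=.
apply: ler_sum => -[v x] _ /=; rewrite !inE.
case: ifPn => [/and3P[vL xv xL]|_]; last by case: ifP => // _; exact: Pr_ge0.
case/and3P: (vL) => -> _ _; case/and3P: (xL) => -> _ _ /=.
by apply: prL; rewrite ?inE // eq_sym.
Qed.

Lemma pr_few_uncoverables Fam S D K : (4 <= #|S|)%N -> (#|Fam| <= #|S|)%N ->
    (forall A, A \in Fam -> [&& A \subset S, 2 <= #|A| & #|A| <= K]%N) ->
    (forall y, (degree Fam y <= D)%N) ->
  Pr R (fun E => #|uncoverables E Fam S|%:R <= 2^-1 ^+ 70 * #|S|%:R ^+ 2 :> R)
    <= expR (- (2^-1 ^+ 141 * #|S|%:R ^+ 2 / (4 * (1 + D * K))%:R ^+ 2)).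
Proof.
move=> S4 FS FamP dD; set c : R := (4 * (1 + D * K))%:R; set m : R := #|S|%:R.
set d : R := 2^-1 ^+ 70.
have d0 : 0 <= d by rewrite exprn_ge0 ?half0.
have d1 : d <= 1 by apply: exprn_ile1; [exact: half0|exact: half1].
have c1 : 1 <= c by rewrite ler1n.
have c0 : 0 < c by lra.
have mu := Ex_uncoverables_ge S4 FS (fun A AF => proj1 (andP (proj2 (andP (FamP A AF))))).
pose f E : R := #|uncoverables E Fam S|%:R.
have fW e E : e \in pairs_in S -> `|f (e |: E) - f (E :\ e)| <= c.
  rewrite inE => /andP[_ /eqP e2]; apply: uncoverables_flip_in => //.
  by move=> A /FamP/and3P[].
have fX e E : e \notin pairs_in S -> f (e |: E) = f (E :\ e).
  by move=> eS; rewrite /f (uncoverables_flip_out E _ eS) // => A /FamP/and3P[].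
have l0 : 0 <= d / c ^+ 2 by rewrite divr_ge0 ?exprn_ge0 // ltW.
have lc : d / c ^+ 2 * c = d / c by rewrite expr2 invfM mulrA divfK ?gt_eqF.
have lc1 : d / c ^+ 2 * c <= 1 by rewrite lc ler_pdivrMr // mul1r; lra.
(* The deviation [d * m ^+ 2] is half the lower bound on the mean. With at most m^2 coordinates,
   [l = d / c ^+ 2] gives the exponent -(d m / c)^2 / 2. *)
have := @bounded_differences R _ c (d / c ^+ 2) (d * m ^+ 2) (pairs_in S) f (ltW c0) l0 lc1 fW fX.
rewrite lc => bd; apply: le_trans (le_trans bd _).
  apply: Pr_le => E fE; apply: le_trans fE _.
  have : 2^-1 ^+ 69 = 2 * d by rewrite /d (exprS _ 69); field.
  move=> d69; rewrite d69 -/m -/f in mu; lra.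
rewrite ler_expR.
have -> : 2^-1 ^+ 141 = d ^+ 2 / 2 by rewrite /d -exprM -exprSr.
have cW : #|pairs_in S|%:R <= m ^+ 2.
  rewrite card_pairs_in bin2 /m -natrX ler_nat -mulnn -divn2.
  by apply: leq_trans (leq_div _ _) _; rewrite leq_mul2l leq_pred orbT.
have -> : d / c ^+ 2 * (d * m ^+ 2) = d ^+ 2 / c ^+ 2 * m ^+ 2 by ring.
have -> : (d / c) ^+ 2 = d ^+ 2 / c ^+ 2 by rewrite exprMn exprVn.
have -> : d ^+ 2 / 2 * m ^+ 2 / c ^+ 2 = d ^+ 2 / c ^+ 2 * (m ^+ 2 / 2) by ring.
have u0 : 0 <= d ^+ 2 / c ^+ 2 by rewrite divr_ge0 ?exprn_ge0 // ltW.
nra.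
Qed.

End Expectation.

(** * From a biclique partition to a block family *)

Section LowerBound.
Local Open Scope nat_scope.
Variable T : finType.
Implicit Types (A B S U : {set T}) (E F : {set {set T}}) (P : {set {set {set T}}}).

Lemma sum_degree (Fam : {set {set T}}) : \sum_y degree Fam y = \sum_(A in Fam) #|A|.
Proof.
have -> : \sum_y degree Fam y = \sum_y \sum_(A in Fam) (y \in A : nat).
  apply: eq_bigr => y _; rewrite /degree -sum1dep_card big_mkcondr.
  by apply: eq_bigr => A _; case: (_ \in _).
rewrite exchange_big; apply: eq_bigr => A _.
by rewrite -sum1_card [RHS]big_mkcond; apply: eq_bigr => y _; case: (_ \in _).
Qed.

Section FixedVertexSet.
Variables (E : {set {set T}}) (P : {set {set {set T}}}) (a b : {set {set T}} -> {set T}).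
Variables (S : {set T}) (K D : nat).
Hypothesis partP : partition P (edges (graph_of E)).
Hypothesis sidesP : forall F, F \in P -> [disjoint a F & b F] /\ F = biclique_edges (a F) (b F).

Let surv := [set F in P | (a F :&: S != set0) && (b F :&: S != set0)].
Hypothesis surv2 : forall F, F \in surv -> (2 <= #|a F :&: S|) && (2 <= #|b F :&: S|).
Hypothesis card_surv : #|surv| <= #|S|.

Let small F := if #|a F :&: S| <= #|b F :&: S| then a F :&: S else b F :&: S.
Let large F := if #|a F :&: S| <= #|b F :&: S| then b F :&: S else a F :&: S.

Let edgeP F u v : F \in P -> u \in small F -> v \in large F ->
  [/\ u \in S, v \in S, u != v, [set u; v] \in F & [set u; v] \in E].
Proof.
move=> FP; have [dF FE] := sidesP FP.
have inE' e : e \in F -> e \in E.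
  move=> eF; have : e \in edges (graph_of E).
    by rewrite -(cover_partition partP); apply/bigcupP; exists F.
  by rewrite inE => /andP[].
rewrite /small /large; case: ifP => _; rewrite !inE => /andP[uF uS] /andP[vF vS].
  have uv : [set u; v] \in F by rewrite FE; apply/imset2P; exists u v.
  split=> //; last exact: inE'.
  by apply: contraTneq vF => <-; rewrite (disjointFr dF uF).
have uv : [set u; v] \in F by rewrite FE setUC; apply/imset2P; exists v u.
split=> //; last exact: inE'.
by apply: contraTneq uF => ->; rewrite (disjointFr dF vF).
Qed.

Let cover_pair u v : u \in S -> v \in S -> u != v -> [set u; v] \in E ->
  exists2 F, F \in surv & [set u; v] \in F /\
    (u \in small F /\ v \in large F \/ v \in small F /\ u \in large F).
Proof.
move=> uS vS uv uvE.
have : [set u; v] \in edges (graph_of E) by rewrite in_graph_of.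
rewrite -(cover_partition partP) => /bigcupP[F FP uvF]; exists F => //.
  have [_ FE] := sidesP FP; move: uvF; rewrite {1}FE => /imset2P[x y xa yb /set2_eqP uvxy].
  rewrite inE FP /=.
  case: uvxy => -[ux vy]; rewrite -?ux -?vy in xa yb; apply/andP; split;
    apply/set0Pn; [exists u|exists v|exists v|exists u]; by rewrite inE ?xa ?yb.
split=> //; have [_ FE] := sidesP FP; move: uvF; rewrite {1}FE => /imset2P[x y xa yb /set2_eqP uvxy].
rewrite /small /large; case: uvxy => -[ux vy]; rewrite -?ux -?vy in xa yb;
  case: ifP => _; rewrite !inE xa yb uS vS; auto.
Qed.

Let small_large F : [disjoint small F & large F] \/ F \notin P.
Proof.
have [FP|] := boolP (F \in P); [left|by right].
have [dF _] := sidesP FP; have dS : [disjoint a F :&: S & b F :&: S].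
  by rewrite -setI_eq0 setIACA (eqP (_ : a F :&: b F == set0)) ?set0I // setI_eq0.
by rewrite /small /large; case: ifP => _ //; rewrite disjoint_sym.
Qed.

Let blocks := [set small F | F in [set F in surv | #|small F| < K]].
(** Dropping all blocks that meet a hub caps every degree in [Fam] at [D], as bounded differences
    require; [hub_pairs] accounts for the edges lost. *)
Let hubs := [set y | D < degree blocks y].
Let Fam := [set A in blocks | [disjoint A & hubs]].
Let bigs := [set (small F, large F) | F in [set F in surv | K <= #|small F|]].

Let small_sub F : small F \subset S.
Proof. by rewrite /small; case: ifP => _; apply: subsetIr. Qed.

Let large_sub F : large F \subset S.
Proof. by rewrite /large; case: ifP => _; apply: subsetIr. Qed.

Let le_small_large F : #|small F| <= #|large F|.
Proof. by rewrite /small /large; case: (leqP #|a F :&: S| #|b F :&: S|) => [|/ltnW]. Qed.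

Let survP F : F \in surv -> F \in P.
Proof. by rewrite inE => /andP[]. Qed.

Let big_bigs : big_family S K bigs.
Proof.
apply/andP; split.
  apply/forall_inP => p /imsetP[F]; rewrite inE => /andP[Fs KF] -> /=.
  rewrite small_sub large_sub KF (leq_trans KF (le_small_large F)) /=.
  by have [//|/negP[]] := small_large F; exact: survP.
apply/forall_inP => p /imsetP[F]; rewrite inE => /andP[/survP Fs _] ->.
apply/forall_inP => q /imsetP[F']; rewrite inE => /andP[/survP Fs' _] ->.
apply/implyP => FF'; have {}FF' : F != F' by apply: contraNneq FF' => ->.
have /trivIsetP /(_ F F' Fs Fs' FF') dFF' : trivIset P by case/and3P: partP.
have sub H : H \in P -> biclique_edges (small H) (large H) \subset H.
  move=> HP; apply/subsetP => _ /imset2P[u v uH vH ->].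
  by have [] := edgeP HP uH vH.
by apply: disjointWl (sub F Fs) _; apply: disjointWr (sub F' Fs') _.
Qed.

Let bigs_sub : family_edges bigs \subset E.
Proof.
apply/bigcupsP => p /imsetP[F]; rewrite inE => /andP[/survP FP _] -> /=.
by apply/subsetP => _ /imset2P[u v uF vF ->]; have [] := edgeP FP uF vF.
Qed.

Let card_blocks : #|blocks| <= #|S|.
Proof.
apply: leq_trans (leq_imset_card _ _) _; apply: leq_trans card_surv.
by apply: subset_leq_card; apply/subsetP => F; rewrite inE => /andP[].
Qed.

Let FamP A : A \in Fam -> [&& A \subset S, 2 <= #|A| & #|A| <= K].
Proof.
rewrite inE => /andP[/imsetP[F]]; rewrite inE => /andP[/surv2/andP[a2 b2] FK] -> _.
by rewrite small_sub (ltnW FK) andbT /small; case: ifP.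
Qed.

Let degFam y : degree Fam y <= D.
Proof.
have [yh|] := boolP (y \in hubs).
  rewrite /degree (eqP (_ : #|_| == 0)) // cards_eq0; apply/eqP/setP => A.
  rewrite !inE; apply/negP => /andP[/andP[_ Ah] yA].
  by rewrite (disjointFr Ah yA) in yh.
rewrite inE -leqNgt; apply: leq_trans; apply: subset_leq_card.
by apply/subsetP => A; rewrite !inE => /andP[/andP[-> _] ->].
Qed.

(** Double counting of incidences: each hub lies in more than [D] blocks, each block has fewer than
    [K] vertices. *)
Let card_hubs : #|hubs| * D <= #|S| * K.
Proof.
apply: (@leq_trans (\sum_y degree blocks y)).
  rewrite -sum_nat_const big_mkcond; apply: leq_sum => y _; rewrite inE.
  by case: ifP => // /ltnW.
rewrite sum_degree; apply: (@leq_trans (\sum_(A in blocks) K)).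
  by apply: leq_sum => A /imsetP[F]; rewrite inE => /andP[_ /ltnW FK] ->.
by rewrite sum_nat_const leq_mul2r card_blocks orbT.
Qed.

(* An edge [{v, y}] lies in a single part, so [v] lies on the large side of at
   most one part having the hub [y] on its small side. *)
Let hub_pairs := \bigcup_(v in S) \bigcup_(y in hubs)
  (let F := pblock P [set v; y] in
   if #|small F| < K then setX [set v] (small F) else set0).

Let card_hub_pairs : #|hub_pairs| <= #|S| * (#|hubs| * K).
Proof.
apply: leq_trans (leq_card_bigcup _ _) _; rewrite -sum_nat_const; apply: leq_sum => v _.
apply: leq_trans (leq_card_bigcup _ _) _; rewrite -sum_nat_const; apply: leq_sum => y _ /=.
by case: ifP => [/ltnW FK|_]; rewrite ?cards0 // cardsX cards1 mul1n.
Qed.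

Let big_pairs := \bigcup_(p in bigs) (setX p.1 p.2 :|: setX p.2 p.1).

Let card_big_pairs : #|big_pairs| <= 2 * #|family_edges bigs|.
Proof.
rewrite (card_family_edges big_bigs) big_distrr /=.
apply: leq_trans (leq_card_bigcup _ _) _; apply: leq_sum => p _.
by apply: leq_trans (leq_card_setU _ _) _; rewrite !cardsX [X in _ + X]mulnC addnn mul2n.
Qed.

(** A discarded block contains a hub [y], and the edge [vy] lies in [F], so [pblock] recovers [F]
    from [v] and [y]. *)
Let hub_pair v x F : F \in surv -> #|small F| < K -> x \in small F -> v \in large F ->
  small F \notin Fam -> (v, x) \in hub_pairs.
Proof.
move=> Fs FK xF vF; rewrite inE negb_and => /orP[/negP[]|].
  by apply: imset_f; rewrite inE Fs.
rewrite -setI_eq0 => /set0Pn[y /setIP[yF yh]].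
have [_ vS _ yvF _] := edgeP (survP Fs) yF vF.
apply/bigcupP; exists v => //; apply/bigcupP; exists y => //=.
have -> : pblock P [set v; y] = F.
  by rewrite setUC; apply: def_pblock; [case/and3P: partP| exact: survP|].
by rewrite FK; apply/setXP; rewrite set11.
Qed.

(** The part containing the edge has a small side of size at least [K], or one discarded because of
    a hub; a block kept in [Fam] would cover the edge. *)
Let uncoverables_sub : uncoverables E Fam S \subset
  big_pairs :|: (hub_pairs :|: [set p | (p.2, p.1) \in hub_pairs]).
Proof.
apply/subsetP => -[v x]; rewrite inE /= => /andP[/setXP[/= vS xS] /andP[xv /forall_inP noA]].
move: (xv); rewrite inE => /andP[vx vxE]; rewrite eq_sym in vx.
have [F Fs [vxF sides]] := cover_pair vS xS vx vxE.
rewrite in_setU; have [FK|FK] := leqP K #|small F|.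
  apply/orP; left; apply/bigcupP; exists (small F, large F).
    by apply/imsetP; exists F => //; rewrite inE Fs.
  by case: sides => -[h1 h2]; rewrite !inE /= h1 h2 ?orbT.
have nbrF w : w \in large F -> small F \subset nbr E w.
  move=> wF; apply/subsetP => y yF; have [_ _ yw _ ywE] := edgeP (survP Fs) yF wF.
  by rewrite inE yw setUC.
apply/orP; right; rewrite in_setU; apply/orP.
case: sides => -[h1 h2]; [right; rewrite inE /= | left]; apply: (hub_pair Fs) => //;
  apply/negP => /noA /andP[].
  by move=> _; rewrite h1 (nbrF x h2).
by rewrite h1 (nbrF v h2).
Qed.

Lemma few_uncoverables : exists (Big : {set {set T} * {set T}}) (Fam' : {set {set T}}) (h : nat),
  [/\ big_family S K Big /\ family_edges Big \subset E,
      [/\ #|Fam'| <= #|S|, forall A, A \in Fam' -> [&& A \subset S, 2 <= #|A| & #|A| <= K]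
        & forall y, degree Fam' y <= D],
      h * D <= #|S| * K
    & #|uncoverables E Fam' S| <= 2 * #|family_edges Big| + 2 * (#|S| * (h * K))].
Proof.
exists bigs, Fam, #|hubs|; split=> //.
  split=> //; apply: leq_trans card_blocks; apply: subset_leq_card.
  by apply/subsetP => A; rewrite inE => /andP[].
apply: leq_trans (subset_leq_card uncoverables_sub) _.
apply: leq_trans (leq_card_setU _ _) _; apply: leq_add => //.
apply: leq_trans (leq_card_setU _ _) _; rewrite mul2n -addnn; apply: leq_add => //.
apply: leq_trans card_hub_pairs.
rewrite -(card_imset _ (can_inj (@swap_pairK T T))); apply: subset_leq_card.
by apply/subsetP => p /imsetP[[u v]]; rewrite inE /= => ? ->.
Qed.
End FixedVertexSet.

(** Deterministic core: the first two hypotheses are the properties required of the graph, the third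
    makes the upper bound of [few_uncoverables] contradict the second. *)
Lemma bipartition_number_ge E (K X D : nat -> nat) (Q m0 : nat) :
    (forall S, m0 <= #|S| -> forall Big, big_family S (K #|S|) Big ->
       family_edges Big \subset E -> #|family_edges Big| <= X #|S|) ->
    (forall S, m0 <= #|S| -> forall Fam : {set {set T}}, #|Fam| <= #|S| ->
       (forall A, A \in Fam -> [&& A \subset S, 2 <= #|A| & #|A| <= K #|S|]) ->
       (forall y, degree Fam y <= D #|S|) -> #|S| ^ 2 < Q * #|uncoverables E Fam S|) ->
    (forall m h, m0 <= m -> h * D m <= m * K m ->
       Q * (2 * X m + 2 * (m * (h * K m))) <= m ^ 2) ->
  #|T| < bipartition_number (graph_of E) + m0.
Proof.
move=> HX HQ Harith; have [P /andP[partP /forall_inP bicP] <-] :=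
  bipartition_number_attained (graph_of E).
rewrite ltnNge; apply/negP => PT.
have /fin_all_exists[ab abP] : forall F, exists ab : {set T} * {set T},
    F \in P -> [disjoint ab.1 & ab.2] /\ F = biclique_edges ab.1 ab.2.
  move=> F; have [FP|FP] := boolP (F \in P); last by exists (set0, set0).
  have /existsP[A /existsP[B /and4P[_ _ dAB /eqP FE]]] := bicP F FP.
  by exists (A, B).
pose a F := (ab F).1; pose b F := (ab F).2.
pose killed U := [set F in P | (a F \subset U) || (b F \subset U)].
have killed0 : #|@set0 T| <= #|killed set0| by rewrite cards0.
case: (@arg_maxnP _ set0 (fun U => #|U| <= #|killed U|) (fun U => #|U|) killed0) => U UK Umax.
have meets A : (A :&: ~: U != set0) = ~~ (A \subset U) by rewrite -setDE setD_eq0.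
pose S := ~: U; pose surv := [set F in P | (a F :&: S != set0) && (b F :&: S != set0)].
have survE : surv = P :\: killed U.
  by apply/setP => F; rewrite !inE !meets negb_and; case: (F \in P); rewrite ?andbF //= negb_or andbT.
(* If a surviving part had a side with trace [[set x]], adding [x] to [U] would kill that part too,
   against maximality. *)
have single F A x : F \in surv -> (A == a F) || (A == b F) -> A :&: S != [set x].
  move=> Fs AF; apply/eqP => Ax.
  have xU : x \notin U by have : x \in A :&: S by [rewrite Ax set11]; rewrite !inE => /andP[].
  have Asub : A \subset x |: U.
    apply/subsetP => y yA; rewrite inE; case: (boolP (y \in U)) => [_|yU]; first by rewrite orbT.
    by rewrite orbF -Ax !inE yA.
  have : #|x |: U| <= #|killed (x |: U)|.
    rewrite cardsU1 xU add1n; apply: (@leq_trans #|F |: killed U|).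
      rewrite cardsU1; move: Fs; rewrite survE inE => /andP[-> _]; rewrite add1n; exact: UK.
    apply: subset_leq_card; apply/subsetP => H; rewrite in_setU1 => /orP[/eqP ->|].
      move: Fs; rewrite !inE => /andP[-> _] /=.
      by case/orP: AF => /eqP <-; rewrite Asub ?orbT.
    rewrite !inE => /andP[-> /orP[h|h]] /=; rewrite (subset_trans h) ?orbT //; exact: subsetUr.
  by move/Umax; rewrite /= cardsU1 xU add1n ltnn.
have surv2 F : F \in surv -> (2 <= #|a F :&: S|) && (2 <= #|b F :&: S|).
  move=> Fs; move: (Fs); rewrite inE => /and3P[_ a0 b0].
  rewrite ![1 < _]ltn_neqAle !card_gt0 a0 b0 !andbT; apply/andP; split.
    by rewrite eq_sym; apply/cards1P => -[x /eqP]; apply/negP/(single F); rewrite ?eqxx.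
  by rewrite eq_sym; apply/cards1P => -[x /eqP]; apply/negP/(single F); rewrite ?eqxx ?orbT.
have cS : #|U| + #|S| = #|T| by rewrite cardsC.
have csurv : #|killed U| + #|surv| = #|P|.
  by rewrite survE -(cardsID (killed U) P) (setIidPr _) //; apply/subsetP => F; rewrite inE => /andP[].
have Sm0 : m0 <= #|S| by move: UK PT; rewrite -cS -csurv; lia.
have survS : #|surv| <= #|S| by move: UK PT; rewrite -cS -csurv; lia.
have [Big [Fam [h [[B1 B2] [F1 F2 F3] hD unc]]]] :=
  @few_uncoverables E P a b S (K #|S|) (D #|S|) partP (fun F => abP F) surv2 survS.
have := HX S Sm0 Big B1 B2; have := HQ S Sm0 Fam F1 F2 F3.
have := Harith _ h Sm0 hD => ar q x.
have : Q * #|uncoverables E Fam S| <= Q * (2 * X #|S| + 2 * (#|S| * (h * K #|S|))).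
  by rewrite leq_mul2l; apply/orP; right; apply: leq_trans unc _; rewrite leq_add2r leq_mul2l x orbT.
by move=> /leq_trans /(_ ar); rewrite leqNgt q.
Qed.

End LowerBound.

(** * Union bound *)

Lemma expRB1_le (R : realType) (x : R) : 0 <= x <= 2^-1 -> expR x - 1 <= 2 * x.
Proof.
move=> /andP[x0 x1].
have : expR x <= (1 - x)^-1.
  rewrite -[x in expR x]opprK expRN lef_pV2 ?posrE ?expR_gt0 ?subr_gt0 //; last by lra.
  exact: expR_ge1Dx.
have : (1 - x)^-1 <= 1 + 2 * x by rewrite -[X in X <= _]mul1r ler_pdivrMr; nra.
lra.
Qed.

Lemma expRN_le_half (R : realType) k : expR (- k%:R) <= 2^-1 ^+ k :> R.
Proof.
rewrite expRN -[k%:R]mulr1 expRM_natl -exprVn lerXn2r ?nnegrE ?invr_ge0 ?expR_ge0 //.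
by rewrite lef_pV2 ?posrE ?expR_gt0 //; apply: le_trans (expR_ge1Dx _).
Qed.

Definition bits m := (trunc_log 2 m).+1.

Lemma ltn_bits m : (m < 2 ^ bits m)%N.
Proof. exact: trunc_log_ltn. Qed.

Section UnionBound.
Variables (R : realType) (T : finType) (l Q m0 : nat).
Implicit Types (S A : {set T}) (E Fam : {set {set T}}).
Hypothesis Tl : (#|T| < 2 ^ l)%N.
Hypothesis QE : Q%:R = 2 ^+ 70 :> R.
Hypothesis m04 : (4 <= m0)%N.
(** The product of 2^141, the bound 2^4 bits^2 l on [t] and the square of the bound 2^85 bits^3 on
    [c] in [pr_few_fail]. *)
Hypothesis m0_large : forall m, (m0 <= m)%N -> 2 ^+ 315 * (bits m)%:R ^+ 8 * l%:R <= m%:R :> R.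

(** [K]: (3/4)^10 <= 2^-4, so (3/4)^K <= m^-4. [X]: (2/3)^2 <= 1/2, so (2/3)^X <= 2^(-2lm). [D]:
    from h D <= m K follows 4 Q K h <= m, so hub pairs use at most half of m^2 in [arith]. *)
Let K m := (10 * bits m)%N.
Let X m := (4 * m * l)%N.
Let D m := (4 * Q * K m ^ 2)%N.

Let Q_gt0 : (0 < Q)%N. Proof. by rewrite -(ltr0n R) QE exprn_gt0. Qed.

Let l_gt0 : (0 < #|T|)%N -> (0 < l)%N.
Proof. by move=> T0; case: l Tl => //; rewrite expn0 ltnS leqn0 => /eqP T00; rewrite T00 in T0. Qed.

Let arith m h : (m0 <= m)%N -> (h * D m <= m * K m)%N ->
  (Q * (2 * X m + 2 * (m * (h * K m))) <= m ^ 2)%N.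
Proof.
move=> mm0 hD.
have hQ : (16 * Q * l <= m)%N.
  rewrite -(ler_nat R) !natrM QE; apply: le_trans (m0_large mm0).
  rewrite ler_wpM2r //; apply: (@le_trans _ _ (2 ^+ 315)).
    have -> : (16 : R) = 2 ^+ 4 by rewrite -natrX.
    rewrite -exprD.
    by rewrite ler_eXn2l ?ltr1n.
  by rewrite ler_peMr ?exprn_ge0 // exprn_ege1 // ler1n.
have hK : (4 * Q * K m * h <= m)%N.
  have K0 : (0 < K m)%N by rewrite muln_gt0.
  by rewrite -(leq_pmul2r K0); apply: leq_trans hD; rewrite /D; lia.
have h1 := leq_mul (leqnn m) hQ; have h2 := leq_mul (leqnn m) hK.
rewrite /X; move: (K m) h1 h2 => k h1 h2; lia.
Qed.

Let big_fail (S : {set T}) (E : {set {set T}}) := [exists F, [&& big_family S (K #|S|) F,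
  ((X #|S|).+1 <= #|family_edges F|)%N & family_edges F \subset E]].

Let good_fam (S : {set T}) (Fam : {set {set T}}) := [&& (#|Fam| <= #|S|)%N,
  [forall A in Fam, [&& A \subset S, 2 <= #|A| & #|A| <= K #|S|]%N] &
  [forall y, degree Fam y <= D #|S|]%N].

Let few_fail (S : {set T}) (E : {set {set T}}) := [exists (Fam | good_fam S Fam),
  (Q * #|uncoverables E Fam S| <= #|S| ^ 2)%N].

Let pr_big_fail S : (m0 <= #|S|)%N -> Pr R (big_fail S) <= expR (expR 2) * 2^-1 ^+ (2 * l * #|S|).
Proof.
move=> mS; have S0 : (0 < #|S|)%N by apply: leq_trans mS; lia.
have m1 : 0 < #|S|%:R :> R by rewrite ltr0n.
apply: le_trans (pr_big_family _ S0 _) _.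
  rewrite /K exprM; apply: (@le_trans _ _ (2^-1 ^+ 4 ^+ bits #|S|)).
    rewrite lerXn2r ?nnegrE ?exprn_ge0 ?invr_ge0 //; lra.
  rewrite -exprM mulnC exprM -[leRHS]exprVn lerXn2r ?nnegrE ?exprn_ge0 ?invr_ge0 //.
  rewrite exprVn lef_pV2 ?posrE ?exprn_gt0 // -natrX ler_nat; exact: ltnW (ltn_bits _).
rewrite ler_wpM2l ?expR_ge0 // exprS.
apply: (@le_trans _ _ ((2 / 3) ^+ X #|S|)).
  have : 0 <= (2 / 3 : R) ^+ X #|S| by rewrite exprn_ge0 //; lra.
  lra.
have -> : X #|S| = (2 * (2 * l * #|S|))%N by rewrite /X; lia.
rewrite exprM lerXn2r ?nnegrE ?exprn_ge0 ?invr_ge0 //; lra.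
Qed.

(** There are at most 2^(bits K) candidate blocks, of which a family takes at most |S|; the [+ 1]
    absorbs the successor in [card_subsets_lek]. *)
Let card_good_fam S :
  (#|[pred Fam | good_fam S Fam]| <= 2 ^ ((bits #|S| * K #|S| + 1) * #|S|))%N.
Proof.
set m := #|S|; set k := K m.
pose Om := [set A : {set T} | (A \subset S) && (#|A| <= k)%N].
have cOm : (#|Om| <= 2 ^ (bits m * k))%N.
  apply: leq_trans (card_subsets_lek _ _) _; by rewrite expnM leq_exp2r ?ltn_bits.
apply: (@leq_trans #|[set F : {set {set T}} | (F \subset Om) && (#|F| <= m)%N]|).
  apply: subset_leq_card; apply/subsetP => Fam; rewrite !inE => /and3P[-> /forall_inP FP _].
  by rewrite andbT; apply/subsetP => A /FP; rewrite inE => /and3P[-> _ ->].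
apply: leq_trans (card_subsets_lek _ _) _; rewrite expnM.
case: (posnP m) => [->|m0']; first by rewrite !expn0.
by rewrite leq_exp2r // addn1 expnS mul2n -addnn -addn1 leq_add // expn_gt0.
Qed.

(** Each family fails with probability at most 2^(-tm). The first part of [t] cancels the number of
    families, and [2 * l] is the surplus for the union bound over [S]. *)
Let pr_few_fail S : (m0 <= #|S|)%N -> Pr R (few_fail S) <= 2^-1 ^+ (2 * l * #|S|).
Proof.
move=> mS; set m := #|S| in mS *.
have m4 : (4 <= m)%N := leq_trans m04 mS.
pose c : R := (4 * (1 + D m * K m))%:R.
pose t := ((bits m * K m + 1) + 2 * l)%N.
have key : t%:R * m%:R <= 2^-1 ^+ 141 * m%:R ^+ 2 / c ^+ 2 :> R.
  have c0 : 0 < c by rewrite ltr0n.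
  have b0 : 1 <= (bits m)%:R :> R by rewrite ler1n.
  have lT : (0 < l)%N.
    by apply: l_gt0; apply: leq_trans (max_card (mem S)); apply: leq_trans m4.
  have l1 : 1 <= l%:R :> R by rewrite ler1n.
  have cle : c <= 2 ^+ 85 * (bits m)%:R ^+ 3.
    have -> : (2 : R) ^+ 85 = Q%:R * 2 ^+ 15 by rewrite QE -exprD.
    rewrite -!natrX -!natrM ler_nat.
    rewrite /D /K; move: (bits m) b0 => b; rewrite ler1n => b0.
    have b3 : (0 < Q * b ^ 3)%N by rewrite muln_gt0 Q_gt0 expn_gt0 b0.
    have -> : (Q * 2 ^ 15 * b ^ 3 = 8 * 4096 * (Q * b ^ 3))%N by rewrite mulnAC mulnC.
    have -> : (4 * Q * (10 * b) ^ 2 * (10 * b) = 4000 * (Q * b ^ 3))%N.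
      by rewrite !expnS !expn0; lia.
    lia.
  have tle : t%:R <= 2 ^+ 4 * (bits m)%:R ^+ 2 * l%:R :> R.
    rewrite -!natrX -!natrM ler_nat /t /K.
    move: (bits m) b0 => b; rewrite ler1n => b0.
    have : (0 < b * b * l)%N by rewrite !muln_gt0 b0.
    have : (b * b <= b * b * l)%N by rewrite leq_pmulr.
    have : (l <= b * b * l)%N by rewrite leq_pmull // muln_gt0 b0.
    rewrite !expnS !expn0; lia.
  rewrite ler_pdivlMr ?exprn_gt0 //.
  have c2 : c ^+ 2 <= (2 ^+ 85 * (bits m)%:R ^+ 3) ^+ 2.
    apply: lerXn2r => //; rewrite nnegrE; first exact: ltW.
    by rewrite mulr_ge0 ?exprn_ge0.
  have mle := m0_large mS.
  have h1 : t%:R * c ^+ 2 <= 2 ^+ 174 * (bits m)%:R ^+ 8 * l%:R.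
    have -> : 2 ^+ 174 * (bits m)%:R ^+ 8 * l%:R =
       (2 ^+ 4 * (bits m)%:R ^+ 2 * l%:R) * (2 ^+ 85 * (bits m)%:R ^+ 3) ^+ 2 :> R.
      by rewrite (exprD _ 4 170) (exprM _ 85 2) (exprD _ 2 6) (exprM _ 3 2); ring.
    by apply: ler_pM; rewrite ?exprn_ge0 // ltW.
  have h2 : t%:R * c ^+ 2 <= 2^-1 ^+ 141 * m%:R.
    apply: (@le_trans _ _ (2^-1 ^+ 141 * (2 ^+ 315 * (bits m)%:R ^+ 8 * l%:R))); last first.
      by apply: ler_wpM2l mle; rewrite exprn_ge0 ?invr_ge0.
    have -> : (2 : R) ^+ 315 = 2 ^+ 141 * 2 ^+ 174 by rewrite -exprD.
    have : (2^-1 : R) ^+ 141 * 2 ^+ 141 = 1 by rewrite -exprMn mulVf ?pnatr_eq0 ?expr1n.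
    move: (2^-1 ^+ 141) (2 ^+ 141) (2 ^+ 174) h1 => w u v h1 wu.
    have -> : w * (u * v * (bits m)%:R ^+ 8 * l%:R) = w * u * (v * (bits m)%:R ^+ 8 * l%:R) by ring.
    by rewrite wu mul1r.
  have -> : t%:R * m%:R * c ^+ 2 = m%:R * (t%:R * c ^+ 2) by ring.
  have -> : 2^-1 ^+ 141 * m%:R ^+ 2 = m%:R * (2^-1 ^+ 141 * m%:R) :> R by ring.
  by rewrite ler_wpM2l.
have one (Fam : {set {set T}}) : good_fam S Fam ->
    Pr R (fun E => (Q * #|uncoverables E Fam S| <= m ^ 2)%N) <= 2^-1 ^+ (t * m).
  move=> /and3P[Fm /forall_inP FP /forallP FD].
  have := @pr_few_uncoverables R T Fam S (D m) (K m) m4 Fm FP FD.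
  rewrite -/m -/c => h; apply: le_trans (le_trans h _).
    apply: Pr_le => E; rewrite -(ler_nat R) natrM QE natrX => h'.
    rewrite -(ler_pM2l (_ : 0 < 2 ^+ 70)) ?exprn_gt0 // [leRHS]mulrA -exprMn mulfV ?pnatr_eq0 //.
    by rewrite expr1n mul1r.
  apply: le_trans (expRN_le_half _ (t * m)); rewrite ler_expR lerN2.
  by rewrite natrM.
apply: le_trans (Pr_exists _ _ _) _; apply: le_trans (ler_sum _ one) _.
rewrite sumr_const -[leLHS]mulr_natl.
apply: (@le_trans _ _ ((2 ^ ((bits m * K m + 1) * m))%:R * 2^-1 ^+ (t * m))).
  by rewrite ler_wpM2r ?exprn_ge0 ?invr_ge0 // ler_nat card_good_fam.
have -> : (t * m = (bits m * K m + 1) * m + 2 * l * m)%N by rewrite /t mulnDl.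
rewrite exprD natrX; move: ((_ + 1) * m)%N => a.
by rewrite mulrA -exprMn mulfV ?pnatr_eq0 // expr1n mul1r.
Qed.

(** Summing z^|S| over nonempty [S] gives (1 + z)^|T| - 1 <= exp(|T| z) - 1, and |T| z <= 2^-l
    because z = 2^(-2l) and |T| < 2^l. *)
Lemma pr_bipartition_number_small :
  Pr R (fun E => ~~ (#|T| < bipartition_number (graph_of E) + m0)%N)
    <= (expR (expR 2) + 1) * (expR (2^-1 ^+ l) - 1).
Proof.
set C := expR (expR 2) + 1; have C0 : 0 <= C by rewrite addr_ge0 ?expR_ge0.
pose z : R := 2^-1 ^+ (2 * l).
have z0 : 0 <= z by rewrite exprn_ge0 ?invr_ge0.
pose fail (S : {set T}) (E : {set {set T}}) := big_fail S E || few_fail S E.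
apply: (@le_trans _ _ (Pr R (fun E => [exists (S : {set T} | (m0 <= #|S|)%N), fail S E]))).
  apply: Pr_le => E; apply: contraNT; rewrite negb_exists_in => /forall_inP ok.
  apply: (@bipartition_number_ge T E K X D Q m0) => [S mS F F1 F2|S mS Fam F1 F2 F3|].
  - have := ok S mS; rewrite negb_or => /andP[/existsPn /(_ F)].
    by rewrite F1 F2 andbT /= -leqNgt.
  - have := ok S mS; rewrite negb_or => /andP[_]; rewrite negb_exists_in => /forall_inP.
    move=> /(_ Fam); rewrite ltnNge; apply; apply/and3P; split => //.
      by apply/forall_inP.
    by apply/forallP.
  - by move=> m h; exact: arith.
apply: le_trans (Pr_exists _ _ _) _.
apply: (@le_trans _ _ (\sum_(S : {set T} | (m0 <= #|S|)%N) C * z ^+ #|S|)).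
  apply: ler_sum => S mS; apply: le_trans (PrU _ _ _) _.
  by rewrite -exprM mulrDl mul1r lerD ?pr_big_fail ?pr_few_fail.
rewrite -mulr_sumr ler_wpM2l //.
apply: (@le_trans _ _ ((1 + z) ^+ #|T| - 1)).
  have := sum_exp_subsets [set: T] z; rewrite cardsT => <-.
  rewrite [X in _ <= X - 1](bigD1 set0) ?sub0set //= cards0 expr0 addrAC subrr add0r.
  rewrite big_mkcond [leRHS]big_mkcond; apply: ler_sum => S _; rewrite subsetT /=.
  case: ifPn => [mS|_]; last by case: ifP => _ //; rewrite exprn_ge0.
  by case: eqP mS => // ->; rewrite cards0 leqNgt (leq_trans _ m04).
rewrite lerD2r; apply: (@le_trans _ _ (expR z ^+ #|T|)).
  by rewrite lerXn2r ?nnegrE ?expR_ge0 ?addr_ge0 ?expR_ge1Dx.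
rewrite -expRM_natl ler_expR /z mul2n -addnn exprD mulrA.
rewrite -[leRHS]mul1r ler_wpM2r ?exprn_ge0 ?invr_ge0 //.
rewrite exprVn ler_pdivrMr ?exprn_gt0 // mul1r -natrX ler_nat; exact: ltnW.
Qed.

End UnionBound.

(** * Asymptotics *)

Section Asymptotics.
Variable R : realType.

(** With k the truncated logarithm of m, 2^k = exp(k ln 2) dominates the Taylor term of order p + 1;
    one factor k absorbs the constant. *)
Lemma polylog_le (C : R) p : exists M, forall m, (M <= m)%N -> C * (bits m)%:R ^+ p <= m%:R.
Proof.
wlog C0 : C / 0 <= C => [H|].
  have [/H //|C0] := leP 0 C; exists 0%N => m _.
  by apply: (@le_trans _ _ 0) => //; rewrite mulr_le0_ge0 ?exprn_ge0 // ltW.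
pose d : R := ln 2 ^+ p.+1 / p.+1`!%:R.
have d0 : 0 < d by rewrite divr_gt0 ?exprn_gt0 ?ln_gt0 ?ltr1n // ltr0n fact_gt0.
pose k0 := (Num.truncn (C * 2 ^+ p / d)).+1.
exists (2 ^ k0)%N => m km.
have m0 : (0 < m)%N by apply: leq_trans km; rewrite expn_gt0.
have k0m : (k0 <= trunc_log 2 m)%N by rewrite -(trunc_expnK k0 (ltnSn 1)) leq_trunc_log.
apply: (@le_trans _ _ (2 ^+ trunc_log 2 m)); last by rewrite -natrX ler_nat trunc_logP.
rewrite /bits; move: (trunc_log 2 m) k0m => k kk.
have k1 : 1 <= k%:R :> R by rewrite ler1n; apply: leq_trans kk.
have Ck : C * 2 ^+ p <= d * k%:R.
  rewrite [leRHS]mulrC -ler_pdivrMr //; apply: (@le_trans _ _ k0%:R); last by rewrite ler_nat.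
  by rewrite ltW // truncnS_gt.
have dk : d * k%:R ^+ p.+1 <= 2 ^+ k.
  have -> : (2 : R) ^+ k = expR (k%:R * ln 2) by rewrite expRM_natl lnK // posrE.
  apply: le_trans (expR_ge1Dxn p _); last by rewrite mulr_ge0 ?ln_ge0 ?ler1n.
  by rewrite exprMn /d -mulrA [_^-1 * _]mulrC mulrA [ln 2 ^+ _ * _]mulrC lerDr.
apply: le_trans dk; apply: (@le_trans _ _ (C * (2 * k%:R) ^+ p)).
  rewrite ler_wpM2l // lerXn2r ?nnegrE ?mulr_ge0 // -natr1; lra.
by rewrite exprMn mulrA [k%:R ^+ p.+1]exprS mulrA ler_wpM2r ?exprn_ge0.
Qed.

Lemma log2_ge n : (0 < n)%N -> (trunc_log 2 n)%:R <= log2 (n%:R : R).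
Proof.
move=> n0; rewrite /log2 ler_pdivlMr ?ln_gt0 ?ltr1n //.
rewrite mulr_natl -lnXn // ler_ln ?posrE ?exprn_gt0 ?ltr0n //.
by rewrite -natrX ler_nat trunc_logP.
Qed.

Lemma log2_le n : (0 < n)%N -> log2 (n%:R : R) <= (bits n)%:R.
Proof.
move=> n0; rewrite /log2 ler_pdivrMr ?ln_gt0 ?ltr1n //.
rewrite mulr_natl -lnXn // ler_ln ?posrE ?exprn_gt0 ?ltr0n //.
by rewrite -natrX ler_nat ltnW // ltn_bits.
Qed.

Lemma trunc_log_large M : exists N, forall n, (N <= n)%N -> (M <= trunc_log 2 n)%N.
Proof.
by exists (2 ^ M)%N => n Nn; rewrite -(trunc_expnK M (ltnSn 1)) leq_trunc_log.
Qed.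

(* [2 * indep_half n] is [2 log2 n] up to [O(log log n)]. *)
Definition indep_half n := (trunc_log 2 n - 4 * bits (trunc_log 2 n))%N.

(** With L = 4s + j and L <= 2^s, the left side is at most 4 * 2^(3s + j) <= 4 * 2^L. The extra
    factor L turns into a failure probability O(1/L). *)
Lemma indep_half_small n : (0 < n)%N ->
  ((indep_half n).*2 ^ 2 * 2 ^ indep_half n * trunc_log 2 n <= 4 * n)%N.
Proof.
move=> n0; rewrite /indep_half; set L := trunc_log 2 n; set s := bits L.
have Ls : (L <= 2 ^ s)%N := ltnW (ltn_bits L).
set j := (L - 4 * s)%N.
have [->|j0] := posnP j; first by rewrite double0.
apply: (@leq_trans (4 * 2 ^ L)); last by rewrite leq_mul2l trunc_logP.
have jL : (j <= L)%N by rewrite leq_subr.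
have Lj : L = (4 * s + j)%N by rewrite /j; lia.
apply: (@leq_trans ((2 * 2 ^ s) ^ 2 * 2 ^ j * 2 ^ s)).
  apply: leq_mul => //; apply: leq_mul => //.
  by rewrite leq_exp2r // -mul2n leq_mul2l (leq_trans jL).
have -> : (2 ^ L = (2 ^ s) ^ 4 * 2 ^ j)%N by rewrite Lj expnD mulnC -expnM mulnC [(s * 4)%N]mulnC.
have : (0 < 2 ^ s)%N by rewrite expn_gt0.
move: (2 ^ s)%N (2 ^ j)%N => a b a0.
have -> : ((2 * a) ^ 2 * b * a = 4 * (a ^ 3 * b))%N by rewrite !expnS !expn0; lia.
by rewrite leq_mul2l /= leq_mul2r expnS leq_pmull ?orbT.
Qed.

Lemma double_indep_half_le n : (0 < n)%N -> ((indep_half n).*2 <= n)%N.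
Proof.
move=> n0; apply: (@leq_trans (trunc_log 2 n).*2); first by rewrite leq_double leq_subr.
apply: leq_trans (trunc_logP (ltnSn 1) n0).
by case: (trunc_log 2 n) => // L; rewrite expnS -mul2n leq_mul2l /= ltn_expl.
Qed.

Lemma indep_half_cvg (e : R) : 0 < e -> exists N, forall n, (N <= n)%N ->
  `|(indep_half n).*2%:R / log2 (n%:R : R) - 2| <= e.
Proof.
(* With b = bits L the gap log2 n - j is at most 1 + 4b <= 5b, which doubled gives the constant 10;
   b <= b^16 since b >= 1. *)
move=> e0; have [M HM] := polylog_le (10 / e) 16.
have [N HN] := trunc_log_large (maxn M 1).
exists (maxn N 1) => n; rewrite geq_max => /andP[/HN]; rewrite geq_max => /andP[ML L1] n0.
have y1 := log2_ge n0; have y2 := log2_le n0.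
rewrite /bits -natr1 in y2.
move: (log2 _) y1 y2 => y y1 y2.
have HB : 10 * (bits (trunc_log 2 n))%:R ^+ 16 <= (trunc_log 2 n)%:R * e.
  by have := HM _ ML; rewrite mulrAC ler_pdivrMr.
have hge : (trunc_log 2 n)%:R - 4 * (bits (trunc_log 2 n))%:R <= (indep_half n)%:R :> R.
  by rewrite lerBlDr -natrM -natrD ler_nat /indep_half; lia.
have hle : (indep_half n)%:R <= (trunc_log 2 n)%:R :> R by rewrite ler_nat leq_subr.
have L1' : 1 <= (trunc_log 2 n)%:R :> R by rewrite ler1n.
have b1 : 1 <= (bits (trunc_log 2 n))%:R :> R by rewrite ler1n.
have b16 : (bits (trunc_log 2 n))%:R <= (bits (trunc_log 2 n))%:R ^+ 16 :> R.
  by rewrite ler_eXnr.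
rewrite -muln2 natrM.
set b : R := (bits _)%:R in hge b1 b16 HB *.
set L : R := (trunc_log 2 n)%:R in y1 y2 hge hle L1' HB *.
move: (b ^+ 16) (indep_half n)%:R b16 HB hge hle => B j b16 HB hge hle.
have y0 : 0 < y by lra.
have -> : j * 2 / y - 2 = - (2 * (y - j) / y) by field; rewrite gt_eqF.
rewrite normrN ger0_norm ?divr_ge0 ?mulr_ge0 //; try lra.
rewrite ler_pdivrMr //.
have : e * L <= e * y by rewrite ler_wpM2l // ltW.
lra.
Qed.

Lemma pr_bipartition_number_large n :
    (8 <= trunc_log 2 n)%N ->
  Pr R (fun E : {set {set 'I_n}} =>
    ~~ (bipartition_number (graph_of E) <= n - (indep_half n).*2)%N) <= 8 / (trunc_log 2 n)%:R.
Proof.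
move=> L8; have n0 : (0 < n)%N by case: n L8.
have n0' : (0 < #|'I_n|)%N by rewrite card_ord.
have L0 : 0 < (trunc_log 2 n)%:R :> R by rewrite ltr0n; apply: leq_trans L8.
have kn := double_indep_half_le n0.
have := @pr_no_independent R 'I_n _ (indep_half n) erefl n0'; rewrite card_ord => /(_ kn).
set r := (_ * _ : R) => h; apply: (@le_trans _ _ (expR r - 1)).
  apply: le_trans h; apply: Pr_le => E; apply: contraNN => /existsP[A /andP[/eqP Ak dA]].
  rewrite -Ak; apply: bipartition_number_indep => u v uA vA.
  have [->|uv] := eqVneq u v.
    by rewrite in_setI inE cards2 eqxx andbF.
  rewrite in_graph_of //; apply/negP => uvE.
  suff : [set u; v] \in pairs_in A by move/(disjointFr dA); rewrite uvE.
  by rewrite inE subUset !sub1set uA vA cards2 uv.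
have r0 : 0 <= r by rewrite !mulr_ge0 ?exprn_ge0 ?invr_ge0.
have rle : r <= 4 / (trunc_log 2 n)%:R.
  rewrite ler_pdivlMr // /r.
  have -> : (indep_half n).*2%:R * (2 ^+ indep_half n * (indep_half n).*2%:R / n%:R) * (trunc_log 2 n)%:R
    = ((indep_half n).*2 ^ 2 * 2 ^ indep_half n * trunc_log 2 n)%N%:R / n%:R :> R.
    by rewrite !natrM !natrX; ring.
  by rewrite ler_pdivrMr ?ltr0n // -natrM ler_nat indep_half_small.
have r2 : r <= 2^-1.
  apply: (le_trans rle); rewrite ler_pdivrMr //.
  have : 8 <= (trunc_log 2 n)%:R :> R by rewrite (ler_nat R 8).
  lra.
apply: le_trans (expRB1_le _) _; first by rewrite r0.
lra.
Qed.

(** With [m0] the integer part of the error term, eventually m0 >= (bits n)^2. So for m >= m0 both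
    [bits n] and 2^315 (bits m)^8 are at most sqrt m, which gives [m0_large]. *)
Lemma pr_bipartition_number_small_asymptotic (c eps : R) : 0 < c -> 0 < eps ->
  exists C : R, exists N, forall n, (N <= n)%N ->
  Pr R (fun E : {set {set 'I_n}} =>
    ~~ (n%:R - c * (log2 (n%:R : R) `^ (3 + eps)) <= (bipartition_number (graph_of E))%:R :> R))
   <= C / (trunc_log 2 n)%:R.
Proof.
move=> c0 eps0; pose C0 : R := expR (expR 2) + 1.
have C00 : 0 <= C0 by rewrite addr_ge0 ?expR_ge0.
exists (2 * C0).
have [Q QE] : exists Q : nat, Q%:R = 2 ^+ 70 :> R by exists (2 ^ 70)%N; rewrite natrX.
(* The square of 2^315 (bits m)^8 <= sqrt m. *)
have [M HM] := polylog_le ((2 ^+ 315) ^+ 2) 16.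
have [N HN] := trunc_log_large (maxn (maxn M 1) (Num.truncn (9 / c)).+1).
exists N => n Nn; have := HN n Nn; rewrite !geq_max => /andP[/andP[ML L1] Lc].
have n0 : (0 < n)%N by case: n L1 {Nn ML Lc}; rewrite ?trunc_log0.
have y1 := log2_ge n0; set y := log2 _ in y1 *.
set L := trunc_log 2 n in L1 ML Lc y1 *.
have L1' : 1 <= L%:R :> R by rewrite ler1n.
have cL : 9 <= c * L%:R.
  rewrite [leRHS]mulrC -ler_pdivrMr //; apply: (@le_trans _ _ (Num.truncn (9 / c)).+1%:R); last by rewrite ler_nat.
  by rewrite ltW // truncnS_gt.
set w := c * _.
(* Since c L >= 9, c L^3 >= 9 L^2 >= (L + 1)^2 + 1; the final 1 compensates the truncation in
   [m0]. *)
have wL : (L%:R + 1) ^+ 2 + 1 <= w.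
  apply: (@le_trans _ _ (c * L%:R ^+ 3)); last first.
    rewrite ler_wpM2l ?(ltW c0) //; apply: (@le_trans _ _ (y ^+ 3)).
      by rewrite lerXn2r ?nnegrE //; lra.
    rewrite -powR_mulrn; last by lra.
    by apply: ler_powR; lra.
  have -> : c * L%:R ^+ 3 = (c * L%:R) * L%:R ^+ 2 by ring.
  have : 9 * L%:R ^+ 2 <= (c * L%:R) * L%:R ^+ 2 by rewrite ler_wpM2r ?sqr_ge0.
  nra.
have w0 : 0 <= w by apply: le_trans wL; rewrite addr_ge0 ?sqr_ge0.
pose m0 := Num.truncn w.
have m0w : m0%:R <= w by rewrite truncn_le.
have m0L : (bits n ^ 2 <= m0)%N.
  rewrite -ltnS -(ltr_nat R); apply: le_lt_trans (truncnS_gt w).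
  by apply: le_trans wL; rewrite natrX /bits -/L -natr1 lerDl.
have lb : (0 < bits n)%N by [].
have L2 : (2 <= bits n)%N by rewrite ltnS.
have m04 : (4 <= m0)%N by apply: leq_trans m0L; rewrite (leq_exp2r 2 (bits n) (ltn0Sn 1)).
have large m : (m0 <= m)%N -> 2 ^+ 315 * (bits m)%:R ^+ 8 * (bits n)%:R <= m%:R :> R.
  move=> mm.
  have nm : (bits n ^ 2 <= m)%N := leq_trans m0L mm.
  have Mm : (M <= m)%N.
    apply: leq_trans ML _; apply: leq_trans nm; apply: leq_trans (leqnSn L) _.
    by rewrite -[(bits n ^ 2)%N]mulnn leq_pmull.
  have := HM m Mm; set p := 2 ^+ 315 => h.
  have p0 : 0 <= p by rewrite exprn_ge0.
  clearbody p; have b0 : 0 <= (bits m)%:R :> R by [].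
  have nm' : (bits n)%:R ^+ 2 <= m%:R :> R by rewrite -natrX ler_nat.
  move: (bits m)%:R (bits n)%:R (m%:R : R) b0 (ler0n R (bits n)) (ler0n R m) h nm' => b l x b0 l0 x0 h nm'.
  rewrite -(@ler_pXn2r _ 2) // ?nnegrE //; last by rewrite mulr_ge0 // mulr_ge0 ?exprn_ge0.
  have -> : (p * b ^+ 8 * l) ^+ 2 = (p ^+ 2 * b ^+ 16) * l ^+ 2 by ring.
  by rewrite [x ^+ 2]expr2 ler_pM // mulr_ge0 ?exprn_ge0.
have := @pr_bipartition_number_small R 'I_n (bits n) Q m0 _ QE m04 large.
rewrite card_ord => /(_ (ltn_bits n)) h.
apply: le_trans (le_trans h _).
  apply: Pr_le => E; apply: contraNN => lt; rewrite lerBlDr.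
  apply: (@le_trans _ _ (bipartition_number (graph_of E) + m0)%:R); first by rewrite ler_nat ltnW.
  by rewrite natrD lerD2l.
have b0 : 0 <= 2^-1 ^+ bits n :> R by rewrite exprn_ge0 ?invr_ge0.
have b1 : 2^-1 ^+ bits n <= 2^-1 :> R.
  by rewrite /bits exprS ler_piMr ?invr_ge0 // exprn_ile1 ?invr_ge0 //; lra.
have bL : 2^-1 ^+ bits n <= L%:R^-1 :> R.
  rewrite exprVn lef_pV2 ?posrE ?exprn_gt0 ?ltr0n // -natrX ler_nat.
  by apply: leq_trans (ltnW (ltn_expl _ (ltnSn 1))); rewrite leqnSn.
have -> : 2 * C0 / L%:R = C0 * (2 * L%:R^-1) by ring.
rewrite -/C0 ler_wpM2l //; apply: le_trans (expRB1_le _) _; first by rewrite b0.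
by rewrite ler_wpM2l.
Qed.

End Asymptotics.

(* Combination of the two bounds *)
From mathcomp Require Import all_classical all_reals all_analysis.
Import Order.TTheory GRing.Theory Num.Theory.
Import numFieldNormedType.Exports.

Local Open Scope classical_set_scope.
Local Open Scope ring_scope.

Theorem theorem1 (R : realType) (c eps : R) (hc : 0 < c) (heps : 0 < eps) :
  exists2 o1 : nat -> R, o1 @ \oo --> (0 : R) &
    aas_gnp (2^-1 : R) (fun n (G : sgraph 'I_n) =>
      n%:R - c * (log2 (n%:R : R) `^ (3 + eps))
        <= ((bipartition_number G)%:R : R)
        <= n%:R - (2 + o1 n) * log2 (n%:R : R)).
Proof.
(* Chosen so that [(2 + o1 n) * log2 n] is exactly [(indep_half n).*2] once log2 n is nonzero. *)
exists (fun n => (indep_half n).*2%:R / log2 (n%:R : R) - 2).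
  apply/cvgrPdist_le => e e0; have [N HN] := indep_half_cvg e0.
  by near=> n; rewrite sub0r normrN; apply: HN; near: n; exact: nbhs_infty_ge.
have [C [N HN]] := pr_bipartition_number_small_asymptotic hc heps.
apply/cvgrPdist_le => e e0.
(* The two failure probabilities add up to (C + 8)/L, at most [e] once L >= (|C| + 8)/e. *)
have [N' HN'] := trunc_log_large (maxn 8 (Num.truncn ((`|C| + 8) / e)).+1).
near=> n; have Nn : (N <= n)%N by near: n; exact: nbhs_infty_ge.
have : (N' <= n)%N by near: n; exact: nbhs_infty_ge.
move/HN'; rewrite geq_max => /andP[L8 Le].
have n0 : (0 < n)%N by case: (n) L8.
rewrite gnp_prob_Pr.
set A := (X in Pr _ X).
have L0 : 0 < (trunc_log 2 n)%:R :> R by rewrite ltr0n (leq_trans _ L8).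
have -> : 1 - Pr R A = Pr R (predC A) by rewrite PrC.
rewrite ger0_norm ?Pr_ge0 //.
apply: (@le_trans _ _ (C / (trunc_log 2 n)%:R + 8 / (trunc_log 2 n)%:R)).
  refine (le_trans _ (lerD (HN n Nn) (pr_bipartition_number_large R L8))).
  apply: le_trans (PrU _ _ _); apply: Pr_le => E /=.
  rewrite /A negb_and => /orP[->//|h]; apply/orP; right; apply: contraNN h => h.
  have y0 : 0 < log2 (n%:R : R) by apply: lt_le_trans (log2_ge _ n0).
  rewrite [2 + _]addrC subrK divfK ?gt_eqF // lerBrDr -natrD ler_nat.
  by apply: leq_trans (leq_add h (leqnn _)) _; rewrite subnK // double_indep_half_le.
rewrite -mulrDl ler_pdivrMr //.
have : (`|C| + 8) / e <= (trunc_log 2 n)%:R.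
  apply: (@le_trans _ _ (Num.truncn ((`|C| + 8) / e)).+1%:R); last by rewrite ler_nat.
  by rewrite ltW // truncnS_gt.
rewrite ler_pdivrMr // mulrC => h; have := ler_norm C; lra.
Unshelve. all: by end_near.
Qed.
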